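(* Let $G=(V,E)$ be a connected simple graph with a fixed total order on $E$ and a fixed root vertex $v_d$. There exists an acyclic matching on the Hasse diagram of the NBC chromatic complex $C_{\mathrm{NBC}}(G)$ over $\mathcal{A}_2$ such that the critical basis elements are in one-to-one correspondence with the signed NBC spanning trees of $G$, i.e. with the pairs $(T,\sigma)$, $T$ an NBC spanning tree of $G$, $\sigma\in\{+,-\}$.
   Context: $\mathcal{A}_2=\mathbb{Z}[x]/(x^2)$. An enhanced state is $(H,\epsilon)$ with $H$ a spanning subgraph of $G$ and $\epsilon$ assigning $1$ or $x$ to each component of $H$. The chromatic differential is $d(H,\epsilon)=\sum_{e\notin E(H)}(-1)^{\#\{e'\in E(H):e'<e\}}(H\cup e,\epsilon_e)$, where if $e$ merges components $C_1,C_2$ the merged component gets $\epsilon(C_1)\epsilon(C_2)\in\mathcal{A}_2$ (term zero if the product is $0$) and otherwise $\epsilon_e=\epsilon$. A broken circuit is the edge set of a cycle minus its smallest edge; an edge set is NBC if it contains no broken circuit; an NBC spanning tree is a spanning tree with NBC edge set. $C_{\mathrm{NBC}}(G)$ is the free abelian group on enhanced states with NBC edge set, graded by $|E(H)|$, with differential obtained from $d$ by discarding the terms whose edge set is not NBC. For a cochain complex $(C,\partial)$ with basis $\Omega$, its Hasse diagram is the directed graph on $\Omega$ with an edge $c\to c'$ whenever the coefficient $[c:c']$ of $c'$ in $\partial c$ is nonzero. A matching is a set of such edges, no two sharing a vertex; it is acyclic if every matched edge has invertible coefficient and the directed graph obtained by reversing all matched edges has no directed cycle. Critical basis elements are those not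 incident to any matched edge. *)

(* Defs.v *)
From HB Require Import structures.
From mathcomp Require Import all_boot all_order all_algebra.

Set Implicit Arguments.
Unset Strict Implicit.
Unset Printing Implicit Defensive.

Import GRing.Theory.
Local Open Scope ring_scope.

(* A simple graph on V is given by its set E of edges, each a two-element set
   of vertices; a spanning subgraph is a set F of edges. *)
Definition adj (V : finType) (F : {set {set V}}) : rel V :=
  fun x y => [set x; y] \in F.

Definition comps (V : finType) (F : {set {set V}}) : {set {set V}} :=
  equivalence_partition (connect (adj F)) [set: V].

Definition connected_graph (V : finType) (F : {set {set V}}) : bool :=
  [forall x, forall y, connect (adj F) x y].

(* The bound k <= #|V| loses nothing, since the vertices of p are distinct. *)
Definition cycle_edges (V : finType) (E C : {set {set V}}) : bool :=
  [exists k : 'I_#|V|.+1, exists p : k.-tuple V,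
    [&& (2 < k)%N, uniq p, cycle (adj E) p
      & C == [set [set x; next p x] | x in p]]].

Definition broken_circuit (V : finType) (E : {set {set V}}) (le : rel {set V})
    (B : {set {set V}}) : bool :=
  [exists C : {set {set V}}, cycle_edges E C &&
    [exists e in C, [forall f in C, le e f] && (B == C :\ e)]].

Definition nbc (V : finType) (E : {set {set V}}) (le : rel {set V})
    (F : {set {set V}}) : bool :=
  [forall B, broken_circuit E le B ==> ~~ (B \subset F)].

Definition spanning_tree (V : finType) (E T : {set {set V}}) : bool :=
  [&& T \subset E, connected_graph T & ~~ [exists C, cycle_edges T C]].

Definition nbc_tree (V : finType) (E : {set {set V}}) (le : rel {set V})
    (T : {set {set V}}) : bool :=
  spanning_tree E T && nbc E le T.

(* The label x^i of a component, i.e. 1 or x, is encoded by its exponent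
   i : 'I_2.  A labelling of the components of F is a function on all vertex
   sets, normalised to 0 on those that are not components. *)
Definition labelling (V : finType) := {ffun {set V} -> 'I_2}.

Definition is_state (V : finType) (E : {set {set V}})
    (s : {set {set V}} * labelling V) : bool :=
  (s.1 \subset E) && [forall C, (C \notin comps s.1) ==> (s.2 C == ord0)].

Definition state (V : finType) (E : {set {set V}}) := {s | is_state E s}.

(* The components of F containing an endpoint of e: two of them if e merges
   components, one otherwise. *)
Definition touched (V : finType) (F : {set {set V}}) (e : {set V}) :
    {set {set V}} :=
  [set C in comps F | ~~ [disjoint C & e]].

(* The labelling eps_e, or None if the product of the two merged labels is 0:
   in Z[x]/(x^2), x^i * x^j is x^(i + j) if i + j < 2, and 0 otherwise. *)
Definition relabel (V : finType) (F : {set {set V}}) (eps : labelling V)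
    (e : {set V}) : option (labelling V) :=
  if #|touched F e| == 2%N then
    if insub (\sum_(C in touched F e) eps C)%N is Some a then
      Some [ffun D : {set V} =>
              if D == cover (touched F e) then a
              else if D \in touched F e then ord0 else eps D]
    else None
  else Some eps.

Definition add_edge (V : finType) (s : {set {set V}} * labelling V)
    (e : {set V}) : option ({set {set V}} * labelling V) :=
  omap (pair (e |: s.1)) (relabel s.1 s.2 e).

Definition edge_sign (V : finType) (le : rel {set V}) (F : {set {set V}})
    (e : {set V}) : int :=
  (-1) ^+ #|[set e' in F | (e' != e) && le e' e]|.

Lemma adj_sym (V : finType) (F : {set {set V}}) : symmetric (adj F).
Proof. by move=> x y; rewrite /adj setUC. Qed.

Lemma compsP (V : finType) (F : {set {set V}}) (C : {set V}) :
  reflect (exists x, C = [set y | connect (adj F) x y]) (C \in comps F).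
Proof.
apply: (iffP imsetP) => [[x _ ->] | [x ->]]; exists x => //;
  by apply/setP=> y; rewrite !inE.
Qed.

Lemma connect_adjU (V : finType) (F : {set {set V}}) (e : {set V}) x y :
  connect (adj F) x y -> connect (adj (e |: F)) x y.
Proof.
apply: connect_sub => a b ab; apply: connect1.
by rewrite /adj in_setU1; apply/orP; right.
Qed.

Lemma comps_untouched (V : finType) (F : {set {set V}}) (e C : {set V}) :
  C \in comps F -> C \notin touched F e -> C \in comps (e |: F).
Proof.
move=> CF; rewrite inE CF /= negbK => dCe.
have /compsP [x defC] := CF; apply/compsP; exists x.
have clC : closed (adj (e |: F)) C.
  move=> a b; rewrite /adj in_setU1 => /orP[/eqP abe | abF].
    have -> : (a \in C) = false by rewrite (disjointFl dCe) // -abe set21.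
    by rewrite (disjointFl dCe) // -abe set22.
  rewrite defC !inE; apply/idP/idP => H; apply: connect_trans H (connect1 _) => //.
  by rewrite adj_sym.
apply/setP=> y; rewrite inE; apply/idP/idP => [|xy].
  by rewrite defC inE => /(connect_adjU e).
by rewrite -(closed_connect clC xy) defC inE connect0.
Qed.

Lemma comps_merged (V : finType) (F : {set {set V}}) (e : {set V}) :
  #|e| = 2%N -> cover (touched F e) \in comps (e |: F).
Proof.
move/eqP/cards2P => [u [v [_ defe]]]; set U := cover _.
have inU a b : connect (adj F) a b -> b \in e -> a \in U.
  move=> ab be; apply/bigcupP; exists [set y | connect (adj F) a y].
    rewrite inE; apply/andP; split; first by apply/compsP; exists a.
    by apply/pred0Pn; exists b; rewrite /= inE ab be.
  by rewrite inE connect0.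
have Uin a : a \in U -> exists2 b, b \in e & connect (adj F) a b.
  case/bigcupP=> C; rewrite inE => /andP[/compsP[x ->] /pred0Pn[b /andP[]]].
  rewrite /= !inE => xb be xa; exists b => //.
  by apply: connect_trans xb; rewrite (sym_connect_sym (@adj_sym _ F)).
have clU : closed (adj (e |: F)) U.
  have symF' : connect_sym (adj (e |: F)).
    by apply/sym_connect_sym/adj_sym.
  apply: intro_closed => // a b; rewrite /adj in_setU1 => /orP[/eqP abe | abF].
    by move=> _; apply: (inU b b) => //; rewrite -abe set22.
  case/Uin=> c ce ac; apply: inU ce; apply: connect_trans ac.
  by apply: connect1; rewrite adj_sym.
apply/compsP; exists u; apply/setP=> y; rewrite inE; apply/idP/idP => [|uy].
  case/Uin=> c; rewrite defe !inE => /orP[]/eqP-> yc;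
    rewrite (sym_connect_sym (@adj_sym _ _)).
    exact: connect_adjU.
  apply: connect_trans (connect_adjU _ yc) (connect1 _).
  by rewrite /adj setUC in_setU1 eqxx.
rewrite -(closed_connect clU uy); apply: (inU u u) => //.
by rewrite defe set21.
Qed.

Lemma touched_card (V : finType) (F : {set {set V}}) (e : {set V}) :
  #|e| = 2%N -> #|touched F e| = 1%N \/ #|touched F e| = 2%N.
Proof.
move=> e2.
have le2 : (#|touched F e| <= 2)%N.
  rewrite -e2; apply: leq_trans (leq_imset_card (fun b => [set y | connect (adj F) b y]) e).
  apply: subset_leq_card; apply/subsetP=> C.
  rewrite inE => /andP[/compsP[x ->] /pred0Pn[b /andP[]]].
  rewrite /= inE => xb be; apply/imsetP; exists b => //.
  apply/setP=> y; rewrite !inE.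
  exact: (same_connect (sym_connect_sym (@adj_sym _ F)) xb).
have gt0 : (0 < #|touched F e|)%N.
  have /card_gt0P [b be] : (0 < #|e|)%N by rewrite e2.
  apply/card_gt0P; exists [set y | connect (adj F) b y].
  rewrite inE; apply/andP; split; first by apply/compsP; exists b.
  by apply/pred0Pn; exists b; rewrite /= inE connect0 be.
by case: #|_| le2 gt0 => [|[|[|]]] // _ _; [left | right].
Qed.

(* chrom_d therefore loses no term: add_edge only produces enhanced states. *)
Lemma add_edge_state (V : finType) (E : {set {set V}})
    (s t : {set {set V}} * labelling V) (e : {set V}) :
  is_state E s -> e \in E -> #|e| = 2%N -> add_edge s e = Some t ->
  is_state E t.
Proof.
case: s => F eps /andP[/= sFE /forallP H] eE e2.
have {}H D : D \notin comps F -> eps D = ord0.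
  by move=> DF; move/implyP: (H D) => /(_ DF) /eqP.
have sub : e |: F \subset E by rewrite subUset sub1set eE.
have un D : D \notin comps (e |: F) -> D \notin touched F e -> eps D = ord0.
  move=> D' nT; apply: H; apply: contra D' => DF; exact: comps_untouched.
rewrite /add_edge /relabel /=; case: eqP => [_ | n2].
  case: insubP => //= a _ _ [<-]; rewrite /is_state /= sub /=.
  apply/forallP=> D; apply/implyP=> D'; rewrite ffunE.
  have [DU | _] := eqVneq D (cover _); first by rewrite DU comps_merged in D'.
  by case: ifP => // /negbT /(un _ D') ->.
case=> <-; rewrite /is_state /= sub /=.
apply/forallP=> D; apply/implyP=> D'; apply/eqP/un => //.
have [/eqP/cards1P [C tC] | //] := touched_card F e2.
apply: contra D' => DT; move: (comps_merged F e2); rewrite tC /cover big_set1.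
by move: DT; rewrite tC inE => /eqP->.
Qed.

(* The image d(s) of a basis element s, as a finitely supported family of
   integer coefficients. *)
Definition chrom_d (V : finType) (E : {set {set V}}) (le : rel {set V})
    (s : state E) : {ffun state E -> int} :=
  [ffun t => \sum_(e in E :\: (val s).1 | add_edge (val s) e == Some (val t))
               edge_sign le (val s).1 e].

Definition nbc_state (V : finType) (E : {set {set V}}) (le : rel {set V}) :=
  {s : state E | nbc E le (val s).1}.

Definition nbc_d (V : finType) (E : {set {set V}}) (le : rel {set V})
    (s : nbc_state E le) : {ffun nbc_state E le -> int} :=
  [ffun t => chrom_d le (val s) (val t)].

Definition lin_ext (Omega : finType) (f : Omega -> {ffun Omega -> int})
    (z : {ffun Omega -> int}) : {ffun Omega -> int} :=
  [ffun c' => \sum_c z c * f c c'].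

Definition nbc_diff (V : finType) (E : {set {set V}}) (le : rel {set V}) :
    {ffun nbc_state E le -> int} -> {ffun nbc_state E le -> int} :=
  lin_ext (@nbc_d V E le).

Definition gen (Omega : finType) (c : Omega) : {ffun Omega -> int} :=
  [ffun c' => (c' == c)%:R].

Definition coef (Omega : finType)
    (d : {ffun Omega -> int} -> {ffun Omega -> int}) (c c' : Omega) : int :=
  d (gen c) c'.

Definition hasse (Omega : finType)
    (d : {ffun Omega -> int} -> {ffun Omega -> int}) : rel Omega :=
  fun c c' => coef d c c' != 0.

Definition matching (Omega : finType)
    (d : {ffun Omega -> int} -> {ffun Omega -> int})
    (M : {set Omega * Omega}) : Prop :=
  (forall p, p \in M -> hasse d p.1 p.2) /\
  (forall p q, p \in M -> q \in M -> p != q ->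
     [disjoint [set p.1; p.2] & [set q.1; q.2]]).

Definition reversed (Omega : finType)
    (d : {ffun Omega -> int} -> {ffun Omega -> int})
    (M : {set Omega * Omega}) : rel Omega :=
  fun c c' => (hasse d c c' && ((c, c') \notin M)) || ((c', c) \in M).

Definition acyclic_matching (Omega : finType)
    (d : {ffun Omega -> int} -> {ffun Omega -> int})
    (M : {set Omega * Omega}) : Prop :=
  [/\ matching d M,
      (forall p, p \in M -> coef d p.1 p.2 \is a GRing.unit)
    & (forall s : seq Omega, cycle (reversed d M) s -> s = [::])].

Definition critical (Omega : finType) (M : {set Omega * Omega}) (c : Omega) :
    bool :=
  [forall p in M, (c != p.1) && (c != p.2)].

Lemma coef_nbc_diff (V : finType) (E : {set {set V}}) (le : rel {set V})
    (s t : nbc_state E le) :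
  coef (@nbc_diff V E le) s t = chrom_d le (val s) (val t).
Proof.
rewrite /coef ffunE (bigD1 s) //= ffunE eqxx mul1r ffunE big1 ?addr0 // => c.
by move=> /negbTE cs; rewrite ffunE cs mul0r.
Qed.

(* Main.v *)
(* Process the edges from the largest to the smallest, deleting those that are
   not in F.  Call e a bridge of F if its ends get disconnected when it is
   removed in its turn; whether e is a bridge depends only on the edges of F
   above e.  Adding a bridge to an NBC set never creates a broken circuit, and F
   together with its bridges is an NBC spanning tree, in which every bridge has
   an end far from the root.  Match an enhanced state by adding or removing its
   largest bridge e such that e belongs to F or the component of F at the far end
   of e is labelled 1.  The critical states are those for which no bridge belongs
   to F and every component but that of the root is labelled x.  Such a state is
   determined by the label of the root component and by the tree T = F + bridges,
   since the bridges of T are those of F.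

   The matching is acyclic: on a cycle let e be the largest edge that varies.
   The number of components labelled x on the far side of e cannot increase, hence
   is constant, so e is only ever added to a far component labelled 1; the next
   step removes e again and leads back to the same state. *)

Require Import Defs.
From HB Require Import structures.
From mathcomp Require Import all_boot all_order all_algebra.

Set Implicit Arguments.
Unset Strict Implicit.
Unset Printing Implicit Defensive.

(** * Connectivity in edge sets, and edges lying on cycles *)

Section Connectivity.

Variable V : finType.
Implicit Types (F G C : {set {set V}}) (e f : {set V}) (x y u v w : V).

Lemma adj_connect_sym F : connect_sym (adj F).
Proof. exact/sym_connect_sym/adj_sym. Qed.

Lemma connect_subset F G x y :
  F \subset G -> connect (adj F) x y -> connect (adj G) x y.
Proof.
move=> sFG; apply: connect_sub => a b ab; apply: connect1.
exact: (subsetP sFG).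
Qed.

Lemma connect_edge F u v : [set u; v] \in F -> connect (adj F) u v.
Proof. exact: connect1. Qed.

Lemma connect_stable F (A : {set V}) x y :
    (forall a b, [set a; b] \in F -> a \in A -> b \in A) ->
  connect (adj F) x y -> x \in A -> y \in A.
Proof.
move=> clA xy xA; have clA' : closed (adj F) A.
  by apply: intro_closed => [|a b]; [exact: adj_connect_sym | exact: clA].
by rewrite -(closed_connect clA' xy).
Qed.

Lemma connect_add_edge F u v x y :
    connect (adj ([set u; v] |: F)) x y ->
  [\/ connect (adj F) x y, connect (adj F) x u /\ connect (adj F) v y
    | connect (adj F) x v /\ connect (adj F) u y].
Proof.
move=> xy; pose P z := [|| connect (adj F) x z,
  connect (adj F) x u && connect (adj F) v z
  | connect (adj F) x v && connect (adj F) u z].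
have : y \in [set z | P z].
  apply: connect_stable xy _; last by rewrite inE /P connect0.
  move=> a b; rewrite in_setU1 !inE => /orP[/eqP eab | abF]; last first.
    rewrite /P => /or3P[xa | /andP[xu va] | /andP[xv ua]].
    - by rewrite (connect_trans xa (connect_edge abF)).
    - by rewrite xu (connect_trans va (connect_edge abF)) orbT.
    - by rewrite xv (connect_trans ua (connect_edge abF)) !orbT.
  have : a \in [set u; v] by rewrite -eab set21.
  have : b \in [set u; v] by rewrite -eab set22.
  rewrite /P !inE => /orP[] /eqP-> /orP[] /eqP->; rewrite ?connect0 ?andbT;
    by case: (connect _ x u); case: (connect _ x v); rewrite ?orbT.
rewrite inE => /or3P[xz | /andP[] | /andP[]]; first by constructor 1.
  by constructor 2.
by constructor 3.
Qed.

Lemma edge_ends e : #|e| = 2 -> exists u v, u != v /\ e = [set u; v].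
Proof. by move/eqP/cards2P=> [u [v [uv ->]]]; exists u, v. Qed.

Lemma other_end e v :
  #|e| = 2 -> v \in e -> exists2 u, u \in e & u != v /\ e = [set u; v].
Proof.
case/edge_ends=> a [b [ab ->]]; rewrite !inE => /orP[]/eqP->.
  by exists b; [exact: set22 | rewrite eq_sym setUC].
by exists a; first exact: set21.
Qed.

Lemma cycle_edges_sub F C : cycle_edges F C -> C \subset F.
Proof.
case/existsP=> k /existsP[p /and4P[_ _ cp /eqP->]].
apply/subsetP=> e /imsetP[x xp ->]; exact: (next_cycle cp xp).
Qed.

Lemma cycle_edges_super F G C :
  F \subset G -> cycle_edges F C -> cycle_edges G C.
Proof.
move=> sFG /existsP[k /existsP[p /and4P[k2 up cp eC]]].
apply/existsP; exists k; apply/existsP; exists p; rewrite k2 up eC andbT /=.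
by apply: sub_cycle cp => a b; apply: (subsetP sFG).
Qed.

Lemma cycle_edges_neq0 F C : cycle_edges F C -> C != set0.
Proof.
case/existsP=> k /existsP[p /and4P[k2 _ _ /eqP->]].
case: p => -[|a p] /= sp; first by rewrite -(eqP sp) in k2.
apply/set0Pn; exists [set a; next (a :: p) a].
by apply: (imset_f (fun x => [set x; next (a :: p) x])); rewrite mem_head.
Qed.

(** The rest of the cycle, followed the other way round, joins the ends of the deleted edge. *)
Lemma connect_cycle_minus F C e u v :
    cycle_edges F C -> e \in C -> u \in e -> v \in e ->
  connect (adj (C :\ e)) u v.
Proof.
case/existsP=> k /existsP[p /and4P[k2 up _ /eqP eC]].
rewrite {1}eC => /imsetP[x xp ee].
have {k2} : 2 < size p by rewrite size_tuple.
case: (rot_to xp) => i q defq.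
have nq : next p =1 next (x :: q) by rewrite -defq; move=> a; rewrite next_rot.
have uq : uniq (x :: q) by rewrite -defq rot_uniq.
have sp : size p = size (x :: q) by rewrite -defq size_rot.
have mq : p =i x :: q by rewrite -defq; move=> a; rewrite mem_rot.
rewrite sp; case: q => [|y q] in defq nq uq sp mq * => //= q0.
have nx : next p x = y by rewrite nq /= eqxx.
(* Another step with edge [e] would have to go from [y] straight back to [x], which only a cycle of
   length 2 allows. *)
have stepC a : a \in p -> a != x -> adj (C :\ e) a (next p a).
  move=> ap ax; rewrite /adj !inE eC (imset_f (fun x => [set x; next p x])) //.
  rewrite andbT ee nx; apply/eqP=> exy.
  have : a \in [set x; y] by rewrite -exy set21.
  rewrite !inE (negPf ax) /= => /eqP ay; move: exy; rewrite ay => exy.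
  have : x \in [set y; next p y] by rewrite exy set21.
  rewrite !inE -ay eq_sym (negPf ax) /= ay => /eqP; rewrite nq.
  case: q q0 uq {defq nq sp mq} => // z q _ /=.
  rewrite !inE !negb_or => /andP[/and3P[xy xz _] _].
  by rewrite [y == x]eq_sym (negPf xy) !eqxx => /esym/eqP; rewrite eq_sym (negPf xz).
have yx : connect (adj (C :\ e)) y x.
  have := cycle_next uq; rewrite /= eqxx /= => /andP[_].
  rewrite rcons_path => /andP[pq /eqP lq].
  have x_notin a : a \in y :: q -> (a \in p) && (a != x).
    move=> aq; rewrite mq inE aq orbT; apply: contraL uq => /eqP <- /=.
    by rewrite aq.
  have lx : next p (last y q) = x by rewrite nq.
  have /andP[lp lnx] := x_notin _ (mem_last y q).
  have lst := connect1 (stepC _ lp lnx); rewrite lx in lst.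
  apply: connect_trans lst; apply/connectP; exists q => //.
  apply: (@sub_in_path _ [pred a | (a \in p) && (a != x)]) pq.
    by move=> a b /andP[ap ax] _ /eqP <-; have := stepC a ap ax; rewrite nq.
  by apply/allP=> a; exact: x_notin.
rewrite [in u \in e]ee [in v \in e]ee nx !inE.
move=> /orP[]/eqP-> /orP[]/eqP->; rewrite ?connect0 //.
by rewrite adj_connect_sym.
Qed.

End Connectivity.

(** * Enhanced states and the effect of adding an edge *)

Section States.

Variables (V : finType) (E : {set {set V}}).
Implicit Types (F : {set {set V}}) (X : {set V}) (e f : {set V}).
Implicit Types (u v w x y : V) (s t : {set {set V}} * labelling V).

Definition component F v : {set V} := [set y | connect (adj F) v y].

Lemma component_comps F v : component F v \in comps F.
Proof. by apply/compsP; exists v. Qed.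

Lemma eq_component F u v : connect (adj F) u v -> component F u = component F v.
Proof.
move=> uv; apply/setP=> y; rewrite !inE.
exact: (same_connect (adj_connect_sym F) uv).
Qed.

Lemma component_eq F u v : component F u = component F v -> connect (adj F) u v.
Proof. by move/setP/(_ v); rewrite !inE connect0. Qed.

(* An enhanced state is recovered from its edge set and the set of vertices
   lying in components labelled x. *)
Definition xset s : {set V} := [set v | s.2 (component s.1 v) != ord0].

Lemma xset_connect s u v :
  connect (adj s.1) u v -> (u \in xset s) = (v \in xset s).
Proof. by rewrite !inE => /eq_component ->. Qed.

Lemma ord2_eq (a b : 'I_2) : (a != ord0) = (b != ord0) -> a = b.
Proof.
by case: a b => [[|[|?]] ?] [[|[|?]] ?] //= _; apply: val_inj.
Qed.

Lemma state_ext s t :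
  is_state E s -> is_state E t -> s.1 = t.1 -> xset s = xset t -> s = t.
Proof.
case: s t => F eps [F' eps'] /= /andP[_ /forallP Hs] /andP[_ /forallP Ht].
move=> eF; rewrite -eF /= in Ht * => /setP eX; congr pair; apply/ffunP=> C.
have [/compsP[x ->] | nC] := boolP (C \in comps F).
  by apply: ord2_eq; have := eX x; rewrite !inE /=.
by move/implyP: (Hs C) => /(_ nC)/eqP->; move/implyP: (Ht C) => /(_ nC)/eqP->.
Qed.

(** Inverse to [xset] when [X] is a union of components; the value [ord0] off the components is the
    normalisation required by [is_state]. *)
Definition mk_state F X : {set {set V}} * labelling V :=
  (F, [ffun C => if (C \in comps F) && (C \subset X) then ord_max else ord0]).

Lemma mk_state_is F X : F \subset E -> is_state E (mk_state F X).
Proof.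
move=> sFE; rewrite /is_state sFE; apply/forallP=> C; apply/implyP=> /= nC.
by rewrite ffunE (negPf nC).
Qed.

Lemma xset_mk_state F X :
    (forall u v, connect (adj F) u v -> u \in X -> v \in X) ->
  xset (mk_state F X) = X.
Proof.
move=> clX; apply/setP=> v; rewrite inE ffunE component_comps /=.
have -> : (component F v \subset X) = (v \in X).
  apply/subsetP/idP => [|vX y]; first by apply; rewrite inE connect0.
  by rewrite inE => /clX; apply.
by case: (v \in X).
Qed.

Lemma touchedE F u v : touched F [set u; v] = [set component F u; component F v].
Proof.
apply/setP=> C; rewrite in_set2 inE; apply/andP/orP.
  case=> /compsP[x ->] /pred0Pn[b /andP[]] /=; rewrite inE => xb.
  by rewrite !inE => /orP[]/eqP <-; [left | right]; apply/eqP/eq_component.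
case=> /eqP->; (split; first exact: component_comps); apply/pred0Pn.
  by exists u; rewrite /= inE connect0 set21.
by exists v; rewrite /= inE connect0 set22.
Qed.

(** Labels are multiplied only when two components merge, and the product vanishes only if both are
    x. *)
Lemma add_edge_defined s u v :
    (u \in xset s -> v \in xset s -> connect (adj s.1) u v) ->
  exists t, add_edge s [set u; v] = Some t.
Proof.
case: s => F eps; rewrite !inE /= => H; rewrite /add_edge /relabel /= touchedE.
case: eqP => [c2|_]; last by exists ([set u; v] |: F, eps).
have ncc : component F u != component F v by move: c2; rewrite cards2; case: eqP.
rewrite big_setU1 ?inE //= big_set1.
case: insubP => [a _ _|]; first by eexists.
case/negP; case: (eps (component F u)) (eps (component F v)) H => [[|[|?]] ?] [[|[|?]] ?] //.
by move=> /(_ isT isT)/eq_component/eqP; rewrite (negPf ncc).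
Qed.

(** A nonzero product is x exactly when one of its factors is, so the new [xset] is the saturation
    of the old one under the new connectivity. *)
Lemma add_edge_some s t u v : add_edge s [set u; v] = Some t ->
  [/\ t.1 = [set u; v] |: s.1,
      u \in xset s -> v \in xset s -> connect (adj s.1) u v
    & xset t = [set w | [exists y in xset s,
                         connect (adj ([set u; v] |: s.1)) w y]]].
Proof.
case: s => F eps; rewrite /add_edge /relabel /= touchedE.
set e := [set u; v].
have ue : u \in e by rewrite set21.
have uve : connect (adj (e |: F)) u v by apply: connect_edge; rewrite setU11.
(* If both ends lie in one component, neither connectivity nor labels change. *)
have [c2 | c2] := eqVneq; last first.
  have uv : connect (adj F) u v.
    apply: component_eq; apply/eqP; apply: contraR c2; rewrite cards2.
    by move->.
  case=> <- /=; split => //.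
  have conE a b : connect (adj (e |: F)) a b = connect (adj F) a b.
    apply/idP/idP => [|ab]; last exact: connect_adjU.
    case/connect_add_edge => // -[au vb].
      exact: connect_trans au (connect_trans uv vb).
    by apply: connect_trans au _; rewrite adj_connect_sym in uv;
       exact: connect_trans uv vb.
  have cE a : component (e |: F) a = component F a by apply/setP=> b; rewrite !inE conE.
  apply/setP=> w; rewrite !inE /= cE; apply/idP/exists_inP => [wX | [y yX]].
    by exists w; rewrite ?connect0 // inE.
  by rewrite conE => wy; move: yX; rewrite inE /= (eq_component wy).
have ncc : component F u != component F v by move: c2; rewrite cards2; case: eqP.
rewrite big_setU1 ?inE //= big_set1.
have covE : cover [set component F u; component F v] = component (e |: F) u.
  apply/setP=> w; rewrite /cover bigcup_setU !big_set1 !inE.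
  apply/orP/idP => [[uw|vw] | uw].
  - exact: connect_adjU.
  - exact: connect_trans uve (connect_adjU _ vw).
  - by case/connect_add_edge: uw => [|[_]|[_]]; [left|right|left].
case: insubP => // a _ vala [<-] /=; split => //.
  move: vala (ltn_ord a) => ->.
  by case: (eps (component F u)) (eps (component F v)) => [[|[|?]] ?] [[|[|?]] ?].
have a0 : (a != ord0) = (u \in xset (F, eps)) || (v \in xset (F, eps)).
  rewrite !inE /=; move: vala; rewrite -val_eqE /= => ->.
  by case: (eps (component F u)) (eps (component F v)) => [[|[|?]] ?] [[|[|?]] ?].
apply/setP=> w; rewrite [in LHS]inE /= ffunE covE [in RHS]inE.
have [eqw | neqw] := eqVneq (component (e |: F) w) (component (e |: F) u).
  have wu := component_eq eqw.
  rewrite a0; apply/orP/exists_inP => [[uX|vX] | [y yX wy]].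
  - by exists u.
  - by exists v => //; exact: connect_trans wu uve.
  - rewrite adj_connect_sym in wu; have := connect_trans wu wy.
    case/connect_add_edge => [uy | [_ vy] | [_ uy]].
    + by left; rewrite (@xset_connect (F, eps) _ _ uy).
    + by right; rewrite (@xset_connect (F, eps) _ _ vy).
    + by left; rewrite (@xset_connect (F, eps) _ _ uy).
have wuN : ~~ connect (adj (e |: F)) w u by apply: contra neqw => /eq_component->.
have cwE : component (e |: F) w = component F w.
  apply/setP=> y; rewrite !inE; apply/idP/idP; last exact: connect_adjU.
  case/connect_add_edge => // -[wz _]; case/negP: wuN.
    exact: connect_adjU.
  by apply: connect_trans (connect_adjU _ wz) _; rewrite adj_connect_sym.
rewrite cwE in_set2; case: ifP => [/orP[]/eqP/component_eq wz | _].
- by case/negP: wuN; exact: connect_adjU.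
- case/negP: wuN.
  by apply: connect_trans (connect_adjU _ wz) _; rewrite adj_connect_sym.
apply/idP/exists_inP => [wX | [y yX wy]].
  by exists w; rewrite ?connect0 // inE.
have : y \in component (e |: F) w by rewrite inE.
by rewrite cwE inE => {}wy; move: yX; rewrite inE /= (eq_component wy).
Qed.

End States.

(** The relation is controlled only on [E], so the maximum is built inside [A] by induction on its
    size; the converse relation gives minima. *)
Lemma exists_maximum (T : finType) (E A : {set T}) (r : rel T) :
    {in E &, total r} -> {in E & &, transitive r} -> A \subset E -> A != set0 ->
  exists2 e, e \in A & forall f, f \in A -> r f e.
Proof.
move=> r_total r_trans.
have r_refl e : e \in E -> r e e by move=> eE; have /orP[] := r_total _ _ eE eE.
move: {2}#|A| (leqnn #|A|) => n; elim: n A => [|n IH] A.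
  by rewrite leqn0 cards_eq0 => ->.
move=> cA sAE /set0Pn[a aA]; have aE := subsetP sAE a aA.
have [A0 | An0] := eqVneq (A :\ a) set0.
  exists a => // f fA; have [-> | fa] := eqVneq f a; first exact: r_refl.
  by move/setP/(_ f): A0; rewrite !inE fa fA.
have [||e] := IH (A :\ a) _ _ An0.
- by move: cA; rewrite (cardsD1 a A) aA.
- exact: subset_trans (subsetDl _ _) sAE.
rewrite !inE => /andP[ea eA] emax; have eE := subsetP sAE e eA.
have /orP[ae | ea'] := r_total _ _ aE eE.
  exists e => // f fA; have [-> // | fa] := eqVneq f a.
  by apply: emax; rewrite !inE fa.
exists a => // f fA; have [-> | fa] := eqVneq f a; first exact: r_refl.
have fE := subsetP sAE f fA.
by apply: (r_trans _ _ _ eE fE aE _ ea'); apply: emax; rewrite !inE fa.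
Qed.

(** * Bridges of an edge set and its completion *)

Section Bridges.

Variables (V : finType) (E : {set {set V}}) (le : rel {set V}) (vd : V).
Hypothesis simpleE : forall e : {set V}, e \in E -> #|e| = 2.
Hypothesis connE : connected_graph E.
Hypothesis le_total : {in E &, total le}.
Hypothesis le_anti : {in E &, antisymmetric le}.
Hypothesis le_trans : {in E & &, transitive le}.

Implicit Types (F T C : {set {set V}}) (e f g : {set V}) (u v w x y z : V).

Lemma le_refl_in e : e \in E -> le e e.
Proof. by move=> eE; have /orP[] := le_total eE eE. Qed.

Lemma le_antisym_in e f : e \in E -> f \in E -> le e f -> le f e -> e = f.
Proof. by move=> eE fE ef fe; apply: le_anti => //; rewrite ef. Qed.

Lemma exists_minimum (A : {set {set V}}) : A \subset E -> A != set0 ->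
  exists2 e, e \in A & forall f, f \in A -> le e f.
Proof.
apply: (@exists_maximum _ _ _ (fun f g => le g f)) => [f g fE gE|f g h fE gE hE].
  exact: le_total.
by move=> gf hg; exact: (le_trans fE hE gE).
Qed.

(* What is left when the edges are processed from the largest down to e, those
   not in F being deleted, and e itself is removed. *)
Definition rest F e : {set {set V}} :=
  [set f in E | (f != e) && (le f e || (f \in F))].

(** For a spanning tree these are its internally active edges in the sense of Tutte: those that are
    smallest in their fundamental cut. *)
Definition bridges F : {set {set V}} :=
  [set e in E | [exists u in e, exists v in e,
                 ~~ connect (adj (rest F e)) u v]].

Definition completion F : {set {set V}} := F :|: bridges F.

(* The end of the bridge e that e separates from the root. *)
Definition far F e v : bool :=
  (v \in e) && ~~ connect (adj (rest (completion F) e)) vd v.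

Lemma bridges_sub F : bridges F \subset E.
Proof. by apply/subsetP=> e; rewrite inE => /andP[]. Qed.

Lemma bridgeE F u v : [set u; v] \in E ->
  ([set u; v] \in bridges F) = ~~ connect (adj (rest F [set u; v])) u v.
Proof.
move=> eE; rewrite inE eE /=; apply/exists_inP/idP; last first.
  move=> nuv; exists u; first exact: set21.
  by apply/exists_inP; exists v; first exact: set22.
case=> a ae /exists_inP[b be]; apply: contra => uv.
have := uv; rewrite adj_connect_sym => vu.
by move: ae be; rewrite !inE => /orP[]/eqP-> /orP[]/eqP->; rewrite ?connect0.
Qed.

Lemma bridge_ends F e : e \in bridges F ->
  exists u v, e = [set u; v] /\ ~~ connect (adj (rest F e)) u v.
Proof.
move=> eB; have eE := subsetP (bridges_sub F) e eB.
have [u [v [_ ee]]] := edge_ends (simpleE eE).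
by exists u, v; split => //; move: eB eE; rewrite ee => eB eE; rewrite -bridgeE.
Qed.

Lemma rest_mono F T e : F \subset T -> rest F e \subset rest T e.
Proof.
move=> sFT; apply/subsetP=> f; rewrite !inE.
case/and3P=> -> -> /= /orP[-> // | /(subsetP sFT) ->]; exact: orbT.
Qed.

(** Enlarging the edge set enlarges [rest], where ends of edges are then more easily connected. *)
Lemma bridges_anti F T : F \subset T -> bridges T \subset bridges F.
Proof.
move=> sFT; apply/subsetP=> e eB; have eE := subsetP (bridges_sub T) e eB.
have [u [v [ee]]] := bridge_ends eB; rewrite ee in eE *; rewrite bridgeE //.
exact/contra/connect_subset/rest_mono.
Qed.

Lemma sub_rest F e : F \subset E -> e \notin F -> F \subset rest F e.
Proof.
move=> sFE eF; apply/subsetP=> f fF; rewrite inE (subsetP sFE) // fF orbT andbT.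
by apply: contraNneq eF => <-.
Qed.

(** The edge [e] is left out because [rest F e] does not depend on it: adding or deleting [e]
    changes neither the bridges from [e] upwards nor their far ends. *)
Definition agree_above e F T : Prop :=
  forall f, f \in E -> f != e -> le e f -> (f \in F) = (f \in T).

Lemma agree_above_le e f F T : e \in E -> f \in E -> le e f ->
  agree_above e F T -> agree_above f F T.
Proof.
move=> eE fE ef agr g gE gf fg; apply: agr (le_trans fE eE gE ef fg) => //.
by apply: contraNneq gf => ge; apply/eqP/le_antisym_in => //; rewrite ge.
Qed.

Lemma rest_agree e F T : e \in E -> agree_above e F T -> rest F e = rest T e.
Proof.
move=> eE agr; apply/setP=> f; rewrite !inE; have [fE | //] := boolP (f \in E).
have [// | fe] /= := eqVneq f e; have /orP[ef | -> //] := le_total eE fE.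
by rewrite (agr f).
Qed.

Lemma bridges_agree e f F T : e \in E -> f \in E -> le e f ->
  agree_above e F T -> (f \in bridges F) = (f \in bridges T).
Proof.
move=> eE fE ef agr; rewrite !inE.
by rewrite (rest_agree fE (agree_above_le eE fE ef agr)).
Qed.

Lemma completion_agree e F T : e \in E ->
  agree_above e F T -> agree_above e (completion F) (completion T).
Proof.
move=> eE agr f fE fe ef.
by rewrite 2!in_setU (agr f fE fe ef) (bridges_agree eE fE ef agr).
Qed.

Lemma far_agree e f F T v : e \in E -> f \in E -> le e f ->
  agree_above e F T -> far F f v = far T f v.
Proof.
move=> eE fE ef agr; rewrite /far.
have agr' := agree_above_le eE fE ef (completion_agree eE agr).
by rewrite (rest_agree fE agr').
Qed.

(* The added bridges can be discarded one at a time, the largest first: in the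
   graph left when it is processed, all the others are still present. *)
Lemma bridges_completion F T :
  F \subset T -> T \subset completion F -> bridges T = bridges F.
Proof.
move=> sFT sTF; apply/eqP; rewrite eqEsubset bridges_anti //=.
apply/subsetP=> e eB; have eE := subsetP (bridges_sub F) e eB.
have [u [v [ee nuv]]] := bridge_ends eB.
have uve : [set u; v] \in E by rewrite -ee.
rewrite ee bridgeE // -ee.
(* With [S] the edges of [T] above [e] that [F] lacks, [rest F e :|: S] contains [rest T e]; a
   general [S] allows induction on its size. *)
suff key (S : {set {set V}}) : S \subset bridges F :\: F ->
    (forall f, f \in S -> le e f && (f != e)) ->
    ~~ connect (adj (rest F e :|: S)) u v.
  apply: contra (key [set f in T | [&& f \notin F, le e f & f != e]] _ _).
  - apply: connect_subset; apply/subsetP=> f; rewrite !inE.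
    case/and3P=> fE fe /orP[-> | fT]; first by rewrite fE fe.
    rewrite fE fe fT /=; case: (f \in F); rewrite ?orbT //=.
    by have /orP[->|->] := le_total eE fE; rewrite ?orbT.
  - apply/subsetP=> f; rewrite in_setD => /setIdP[fT /and3P[nfF _ _]].
    by move/(subsetP sTF): fT; rewrite nfF in_setU (negPf nfF).
  - by move=> f; rewrite !inE => /and4P[_ _ -> ->].
move: {2}#|S| (leqnn #|S|) => n; elim: n S => [|n IH] S.
  by rewrite leqn0 cards_eq0 => /eqP-> _ _; rewrite setU0.
move=> cS sSB Sgt; have [-> | Sn0] := eqVneq S set0; first by rewrite setU0.
have sSE : S \subset E.
  by apply: subset_trans sSB (subset_trans (subsetDl _ _) (bridges_sub F)).
have [f fS fmax] := exists_maximum le_total le_trans sSE Sn0.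
have nuvS : ~~ connect (adj (rest F e :|: S :\ f)) u v.
  apply: IH.
  - by move: cS; rewrite (cardsD1 f S) fS.
  - exact: subset_trans (subsetDl _ _) sSB.
  - by move=> g; rewrite !inE => /andP[_ /Sgt].
have fE := subsetP sSE f fS; have /andP[ef fe] := Sgt f fS.
have /setDP[fB fF] := subsetP sSB f fS.
have [a [b [ef' nab]]] := bridge_ends fB.
(* Since [f] is the largest element of [S] and lies above [e], all these edges are still present
   when [f] is processed. *)
have sub : rest F e :|: S :\ f \subset rest F f.
  apply/subsetP=> g; rewrite inE => /orP[|]; rewrite !inE.
    case/and3P=> gE ge /orP[lge | gF]; rewrite gE /=.
      rewrite (le_trans eE gE fE) //= andbT.
      apply: contraNneq ge => gf; apply/eqP/le_antisym_in => //.
      by rewrite gf.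
    by rewrite gF orbT andbT; apply: contraNneq fF => <-.
  by case/andP=> gf gS; rewrite (subsetP sSE) // gf fmax.
(* The edge [e] itself survives in [rest F f], so a path from [u] to [v] through [f] would connect
   the ends of [f] there. *)
have uvf : connect (adj (rest F f)) u v.
  by apply: connect_edge; rewrite -ee inE eE eq_sym fe ef.
have defS : rest F e :|: S = [set a; b] |: (rest F e :|: S :\ f).
  by rewrite -ef' setUCA setD1K.
apply/negP; rewrite defS => /connect_add_edge[uv|[ua bv]|[ub av]].
- by rewrite uv in nuvS.
- case/negP: nab; rewrite adj_connect_sym in ua.
  apply: connect_trans (connect_subset sub ua) (connect_trans uvf _).
  by rewrite adj_connect_sym; exact: connect_subset bv.
- case/negP: nab; rewrite adj_connect_sym.
  rewrite adj_connect_sym in ub.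
  apply: connect_trans (connect_subset sub ub) (connect_trans uvf _).
  by rewrite adj_connect_sym; exact: connect_subset av.
Qed.

Lemma bridges_of_completion F : bridges (completion F) = bridges F.
Proof. by apply: bridges_completion; first exact: subsetUl. Qed.

(* The smallest edge leaving a union of components is always a bridge. *)
Lemma connected_of_bridges T : bridges T \subset T -> connected_graph T.
Proof.
move=> sBT; apply/forallP=> x; apply/forallP=> y; apply/negPn/negP=> nxy.
pose N := component T x.
(* The cut of [E] around the component of [x]; it is nonempty because [E] is connected. *)
pose cross := [set e in E | [exists u in e, exists v in e,
                             (u \in N) && (v \notin N)]].
have crossN : cross != set0.
  apply/negP=> /eqP c0; case/negP: nxy; have : y \in N; last by rewrite inE.
  have xN : x \in N by rewrite inE connect0.
  have xy : connect (adj E) x y by move: connE => /forallP/(_ x)/forallP/(_ y).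
    apply: (connect_stable _ xy xN) => a b abE aN.
  apply: contraT => bN; move/setP/(_ [set a; b]): c0; rewrite !inE abE /=.
  move=> /negbT/negP[]; apply/exists_inP; exists a; first exact: set21.
  by apply/exists_inP; exists b; [exact: set22 | rewrite aN bN].
have scE : cross \subset E by apply/subsetP=> e; rewrite inE => /andP[].
have [e ec emin] := exists_minimum scE crossN.
have clN u v : [set u; v] \in T -> u \in N -> v \in N.
  by rewrite !inE => uvT xu; apply: connect_trans xu (connect_edge uvT).
have := ec; rewrite inE => /andP[eE /exists_inP[u ue /exists_inP[v ve /andP[uN vN]]]].
have ee : e = [set u; v].
  have [a _ [_ ee]] := other_end (simpleE eE) ve.
  move: ue; rewrite ee !inE => /orP[]/eqP eu; first by rewrite eu.
  by rewrite eu (negPf vN) in uN.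
have eT : e \notin T by rewrite ee; apply: contra vN => /clN; apply.
case/negP: eT; apply: (subsetP sBT); rewrite ee bridgeE -?ee //.
apply: contra vN => uv; apply: (connect_stable _ uv uN) => a b.
rewrite inE => /and3P[abE abe /orP[lab | abT] aN]; last exact: clN aN.
apply: contraNT abe => bN; apply/eqP/le_antisym_in => //; apply: emin.
rewrite inE abE; apply/exists_inP; exists a; first exact: set21.
by apply/exists_inP; exists b; [exact: set22 | rewrite aN bN].
Qed.

Lemma completion_connected F x y : connect (adj (completion F)) x y.
Proof.
have : connected_graph (completion F).
  by apply: connected_of_bridges; rewrite bridges_of_completion subsetUr.
by move/forallP/(_ x)/forallP/(_ y).
Qed.

Lemma completion_sub F : F \subset E -> completion F \subset E.
Proof. by move=> sFE; rewrite subUset sFE bridges_sub. Qed.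

(** The graph [rest (completion F) e] keeps all of the connected [completion F] except [e] and
    separates the ends of [e], so the root is connected there to exactly one of them. *)
Lemma far_near F e : F \subset E -> e \in bridges F ->
  exists y z, [/\ e = [set y; z], far F e z,
                  connect (adj (rest (completion F) e)) vd y
                & ~~ connect (adj (rest (completion F) e)) y z].
Proof.
move=> sFE eB; have := eB; rewrite -bridges_of_completion.
case/bridge_ends=> u [v [ee nuv]]; set R := rest _ e in nuv *.
have sR : completion F \subset [set u; v] |: R.
  apply/subsetP=> f fT; rewrite in_setU1 -ee inE; case: eqVneq => //= _.
  by rewrite fT orbT andbT (subsetP (completion_sub sFE)).
have := connect_subset sR (completion_connected F vd u).
have du v' : v' \in e -> ~~ connect (adj R) vd v' -> far F e v'.
  by move=> ve nv; rewrite /far ve.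
have [vdu _ | nvdu] := boolP (connect (adj R) vd u).
  exists u, v; split=> //; apply: du; first by rewrite ee set22.
  by apply: contra nuv => vdv; rewrite adj_connect_sym in vdu;
     exact: connect_trans vdu vdv.
case/connect_add_edge => [vdu | [vdu _] | [vdv _]].
- by rewrite vdu in nvdu.
- by rewrite vdu in nvdu.
exists v, u; split; rewrite 1?setUC // 1?adj_connect_sym //.
by apply: du; rewrite // ee set21.
Qed.

Lemma far_unique F e v z :
  F \subset E -> e \in bridges F -> far F e v -> far F e z -> v = z.
Proof.
move=> sFE eB; have [a [b [-> _ vda _]]] := far_near sFE eB.
rewrite /far !inE.
case/andP=> /orP[]/eqP-> va; first by rewrite vda in va.
by case/andP=> /orP[]/eqP-> vb //; rewrite vda in vb.
Qed.

(* Following [e] from the root side reaches the component of the far end of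
   [e] without using [f], whereas v is cut off from the root by [f]. *)
Lemma far_not_connected F e f z v : F \subset E ->
    e \in bridges F -> f \in bridges F -> e \notin F -> f \notin F ->
    le e f -> e != f -> far F e z -> far F f v ->
  ~~ connect (adj F) z v.
Proof.
move=> sFE eB fB eF fF ef nef fez /andP[vf vdv].
have [y [z' [ee fez' vdy _]]] := far_near sFE eB.
rewrite -(far_unique sFE eB fez fez') in ee => {z' fez'}.
have [eE fE] := (subsetP (bridges_sub F) _ eB, subsetP (bridges_sub F) _ fB).
have [v' _ [_ defF]] := other_end (simpleE fE) vf.
set Ge := rest _ e in vdy; set Gf := rest _ f in vdv.
have sTE := completion_sub sFE.
have sFGe : F \subset Ge.
  exact: subset_trans (sub_rest sFE eF) (rest_mono _ (subsetUl _ _)).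
have sFGf : F \subset Gf.
  exact: subset_trans (sub_rest sFE fF) (rest_mono _ (subsetUl _ _)).
apply: contra vdv => zv.
have nvdv : ~~ connect (adj Ge) vd v.
  case/andP: fez => _; apply: contra => vdv; apply: connect_trans vdv _.
  by rewrite adj_connect_sym; exact: connect_subset zv.
have fGe : f \in Ge by rewrite inE fE eq_sym nef in_setU fB !orbT.
(* A walk from the root in [Ge] cannot use [f]: all it meets is on the root side of [e], and the end
   [v] of [f] is not. *)
have vdyf : connect (adj (Ge :\ f)) vd y.
  suff : y \in component (Ge :\ f) vd by rewrite inE.
  apply: (connect_stable _ vdy); last by rewrite inE connect0.
  move=> a b abG; rewrite !inE => vda; apply: (connect_trans vda).
  apply: connect_edge; rewrite in_setD1 abG andbT; apply: contra nvdv => /eqP abf.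
  have vda' := connect_subset (subsetDl _ _) vda.
  have : v \in [set a; b] by rewrite abf.
  rewrite !inE => /orP[]/eqP-> //.
  exact: connect_trans vda' (connect_edge abG).
have sGf : Ge :\ f \subset Gf.
  apply/subsetP=> g /setD1P[gf /setIdP[gE /andP[ge H]]].
  rewrite inE gE gf; case/orP: H => [lge | ->]; rewrite ?orbT //.
  by rewrite (le_trans eE gE fE).
apply: connect_trans (connect_subset sGf vdyf) _.
apply: connect_trans (connect_subset sFGf zv).
by apply: connect_edge; rewrite -ee inE eE nef ef.
Qed.

(** * NBC sets, spanning trees and completions *)

Lemma nbc_subset F T : F \subset T -> nbc E le T -> nbc E le F.
Proof.
move=> sFT /forallP nT; apply/forallP=> B; apply/implyP=> bB.
move/implyP: (nT B) => /(_ bB); apply: contra => sBF.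
exact: subset_trans sBF sFT.
Qed.

(** The other edges of the cycle reconnect the ends of [e] in [rest (completion F) e]: they lie in
    the completion, except [f], which is below [e]. *)
Lemma circuit_meets_no_bridge F C f e :
    cycle_edges E C -> f \in C -> (forall g, g \in C -> le f g) ->
  C :\ f \subset completion F -> e \in C :\ f -> e \notin bridges F.
Proof.
move=> cC fC fmin sCF /setD1P[ef eC].
rewrite -bridges_of_completion; apply/negP=> /bridge_ends[u [v [ee]]]; case/negP.
apply: connect_subset (connect_cycle_minus cC eC _ _); rewrite ?ee ?set21 ?set22 //.
apply/subsetP=> g /setD1P[ge gC]; rewrite inE (subsetP (cycle_edges_sub cC)) //.
rewrite ge /=; have [-> | gf] := eqVneq g f; first by rewrite fmin -?ee.
by rewrite (subsetP sCF) ?orbT // !inE gf.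
Qed.

(** A broken circuit inside the completion contains no bridge, hence already lies in [F]. *)
Lemma completion_nbc F : nbc E le F -> nbc E le (completion F).
Proof.
move=> nF; apply/forallP=> B; apply/implyP=> bB; apply/negP=> sBF.
move/forallP/(_ B)/implyP/(_ bB)/negP: nF; case; apply/subsetP=> e eB.
have := subsetP sBF e eB; rewrite in_setU => /orP[// | ebr].
case/existsP: bB => C /andP[cC /exists_inP[f fC /andP[/forall_inP fmin /eqP eBC]]].
rewrite eBC in eB sBF.
by have := circuit_meets_no_bridge cC fC fmin sBF eB; rewrite ebr.
Qed.

(** Deleting the smallest edge of a cycle of [T] leaves a broken circuit inside [T]. *)
Lemma nbc_no_cycle T : T \subset E -> nbc E le T -> ~~ [exists C, cycle_edges T C].
Proof.
move=> sTE nT; apply/existsP=> -[C cC]; have cCE := cycle_edges_super sTE cC.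
have [e eC emin] :=
  exists_minimum (cycle_edges_sub cCE) (cycle_edges_neq0 cC).
move/forallP/(_ (C :\ e))/implyP: nT => /(_ _)/negP; case.
  apply/existsP; exists C; rewrite cCE; apply/exists_inP; exists e => //.
  by rewrite eqxx andbT; apply/forall_inP.
exact: subset_trans (subsetDl _ _) (cycle_edges_sub cC).
Qed.

Lemma completion_nbc_tree F : F \subset E -> nbc E le F -> nbc_tree E le (completion F).
Proof.
move=> sFE nF; rewrite /nbc_tree completion_nbc // andbT /spanning_tree.
rewrite completion_sub // nbc_no_cycle ?completion_sub ?completion_nbc // andbT.
by apply: connected_of_bridges; rewrite bridges_of_completion subsetUr.
Qed.

(** If [e] were outside [T], all of the connected [T] would survive in [rest T e]. *)
Lemma tree_bridges T : spanning_tree E T -> bridges T \subset T.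
Proof.
case/and3P=> sTE /forallP cT _; apply/subsetP=> e eB.
have [u [v [_ nuv]]] := bridge_ends eB; apply: contraR nuv => eT.
exact: connect_subset (sub_rest sTE eT) (forallP (cT u) v).
Qed.

Lemma completion_add_nbc F e : nbc E le F -> e \in bridges F -> nbc E le (e |: F).
Proof.
move=> nF eB; apply: nbc_subset (completion_nbc nF).
by rewrite subUset sub1set in_setU eB orbT subsetUl.
Qed.

(** [T] lies between [T :\: bridges T] and its completion, so both have the same bridges, and adding
    them back restores [T]. *)
Lemma completion_tree_passive T :
  spanning_tree E T -> completion (T :\: bridges T) = T.
Proof.
move=> tT; have sBT := tree_bridges tT.
have -> : completion (T :\: bridges T) = T :\: bridges T :|: bridges T.
  congr (_ :|: _); apply/esym/bridges_completion; first exact: subsetDl.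
  apply/subsetP=> e eT; rewrite in_setU in_setD eT andbT.
  have [eB | //] := boolP (e \in bridges T).
  exact: (subsetP (bridges_anti (subsetDl _ _))).
by apply/setP=> e; rewrite !in_setU in_setD; have := subsetP sBT e;
   case: (e \in bridges T) => [->|_] //=; rewrite orbF.
Qed.

(** When [completion F] is a spanning tree, this says that [F] is the set of its internally passive
    edges. *)
Definition passive F : bool := [disjoint F & bridges F].

(* Walk in the tree [completion F] from the root to the component of [w] and stop
   at the first edge entering it. *)
Lemma passive_far F w : F \subset E -> passive F -> ~~ connect (adj F) vd w ->
  exists e v, [/\ e \in bridges F, far F e v & connect (adj F) v w].
Proof.
move=> sFE pF nw; pose C := component F w.
pose H := [set f in completion F | [disjoint f & C]].
have HC x : connect (adj H) vd x -> x \notin C.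
  move=> vdx; suff : x \in ~: C by rewrite inE.
  apply: (connect_stable _ vdx); last by rewrite !inE adj_connect_sym.
  move=> a b; rewrite inE => /andP[_ dab] _; rewrite inE.
  by rewrite (disjointFr dab) // set22.
have : ~~ connect (adj H) vd w.
  by apply/negP=> /HC; rewrite inE connect0.
have [/existsP[a /existsP[b /and3P[abT vda nvdb]]] _ | ncr] := boolP
    [exists a, exists b, [&& [set a; b] \in completion F,
      connect (adj H) vd a & ~~ connect (adj H) vd b]]; last first.
  case/negP; suff : w \in component H vd by rewrite inE.
  apply: (connect_stable _ (completion_connected F vd w)).
    move=> a b abT; rewrite !inE => vda; apply: contraR ncr => nvdb.
    by apply/existsP; exists a; apply/existsP; exists b; rewrite abT vda.
  by rewrite inE connect0.
have aC := HC a vda.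
have bC : b \in C.
  have : [set a; b] \notin H.
    by apply: contra nvdb => abH; exact: connect_trans vda (connect_edge abH).
  rewrite inE abT /= => /pred0Pn[c /andP[]] /=; rewrite !inE => /orP[]/eqP-> //.
  by move=> wa; rewrite inE wa in aC.
have abF : [set a; b] \notin F.
  apply: contra aC => abF; move: bC; rewrite !inE => wb.
  by apply: connect_trans wb _; rewrite adj_connect_sym; exact: connect_edge.
have abB : [set a; b] \in bridges F by move: abT; rewrite in_setU (negPf abF).
exists [set a; b], b; split=> //; last by move: bC; rewrite inE adj_connect_sym.
have abE := subsetP (bridges_sub F) _ abB.
(* The walk from the root to [a] avoids [C] and hence this edge; reaching [b] as well would connect
   the two ends of a bridge. *)
rewrite /far set22 /=; have := abB; rewrite -bridges_of_completion bridgeE //.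
apply: contra => vdb; apply: connect_trans vdb; rewrite adj_connect_sym.
apply: connect_subset vda; apply/subsetP=> f; rewrite inE => /andP[fT dfC].
rewrite inE (subsetP (completion_sub sFE)) // fT orbT andbT /=.
by apply: contraTneq dfC => ->; apply/pred0Pn; exists b; rewrite /= set22.
Qed.

(** * NBC states and the terms of the differential *)

Implicit Types (X : {set V}) (s t : nbc_state E le).

Definition ed s : {set {set V}} := (val (val s)).1.
Definition xs s : {set V} := xset (val (val s)).

Lemma ed_sub s : ed s \subset E.
Proof. by have /andP[] := valP (val s). Qed.

Lemma ed_nbc s : nbc E le (ed s).
Proof. exact: valP s. Qed.

Lemma xs_connect s u v : connect (adj (ed s)) u v -> (u \in xs s) = (v \in xs s).
Proof. exact: xset_connect. Qed.

Lemma nbc_state_ext s t : ed s = ed t -> xs s = xs t -> s = t.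
Proof.
move=> eF eX; do 2!apply: val_inj; apply: state_ext eF eX; exact: valP.
Qed.

Lemma nbc_state_build F X : F \subset E -> nbc E le F ->
    (forall u v, connect (adj F) u v -> u \in X -> v \in X) ->
  exists s, ed s = F /\ xs s = X.
Proof.
move=> sFE nF clX; pose s0 : state E := Sub _ (mk_state_is X sFE).
exists (Sub s0 nF : nbc_state E le); split => //; exact: xset_mk_state.
Qed.

(** An edge of the Hasse diagram together with the graph edge that produces it. *)
Definition adds s e t : bool :=
  [&& e \in E, e \notin ed s & add_edge (val (val s)) e == Some (val (val t))].

Lemma adds_ed s e t : adds s e t -> ed t = e |: ed s.
Proof.
case/and3P=> eE _ /eqP; have [u [v [_ ->]]] := edge_ends (simpleE eE).
by case/add_edge_some.
Qed.

Lemma adds_in s e t : adds s e t -> e \in ed t.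
Proof. by move/adds_ed->; rewrite setU11. Qed.

Lemma adds_notin s e t : adds s e t -> e \notin ed s.
Proof. by case/and3P. Qed.

Lemma adds_xs s e t w : adds s e t ->
  (w \in xs t) = [exists y in xs s, connect (adj (ed t)) w y].
Proof.
move=> a; rewrite (adds_ed a); case/and3P: a => eE _ /eqP.
have [u [v [_ ->]]] := edge_ends (simpleE eE).
by case/add_edge_some=> _ _; rewrite /xs => ->; rewrite inE.
Qed.

(** Two distinct components labelled x never merge, since the product of their labels is zero. *)
Lemma adds_connect s e t x y : adds s e t -> x \in xs s -> y \in xs s ->
  connect (adj (ed t)) x y -> connect (adj (ed s)) x y.
Proof.
move=> a; rewrite (adds_ed a); case/and3P: a => eE _ /eqP.
have [u [v [_ ->]]] := edge_ends (simpleE eE).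
case/add_edge_some=> _ uv _ xX yX /connect_add_edge[// | [xu vy] | [xv uy]].
  have uX : u \in xs s by rewrite -(xs_connect xu).
  have vX : v \in xs s by rewrite (xs_connect vy).
  exact: connect_trans xu (connect_trans (uv uX vX) vy).
have uX : u \in xs s by rewrite (xs_connect uy).
have vX : v \in xs s by rewrite -(xs_connect xv).
have := uv uX vX; rewrite adj_connect_sym => vu.
exact: connect_trans xv (connect_trans vu uy).
Qed.

Lemma adds_xs_sub s e t : adds s e t -> xs s \subset xs t.
Proof.
move=> a; apply/subsetP=> w wX; rewrite (adds_xs _ a); apply/exists_inP.
by exists w; rewrite ?connect0.
Qed.

Lemma adds_defined s u v : [set u; v] \in E -> [set u; v] \notin ed s ->
    (u \in xs s -> v \in xs s -> connect (adj (ed s)) u v) ->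
    nbc E le ([set u; v] |: ed s) ->
  exists t, adds s [set u; v] t.
Proof.
move=> eE eF uv nF; have [t st] := add_edge_defined uv.
have t_state := add_edge_state (valP (val s)) eE (simpleE eE) st.
have nt : nbc E le (val (Sub t t_state : state E)).1.
  by case: (add_edge_some st) => /= ->.
by exists (Sub (Sub t t_state : state E) nt); rewrite /adds eE eF st /=.
Qed.

Lemma adds_agree s e t : adds s e t -> agree_above e (ed s) (ed t).
Proof. by move=> a f fE fe _; rewrite (adds_ed a) in_setU1 (negPf fe). Qed.

Lemma hasse_adds s t : hasse (@nbc_diff V E le) s t -> exists e, adds s e t.
Proof.
rewrite /hasse coef_nbc_diff ffunE => H.
have [/existsP[e /andP[/setDP[eE eF] ae]] | /existsPn no] := boolP
    [exists e, (e \in E :\: (val (val s)).1)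
             && (add_edge (val (val s)) e == Some (val (val t)))].
  by exists e; rewrite /adds eE eF.
by rewrite big1 ?eqxx // in H => e He; case/negP: (no e).
Qed.

(** The edge sets of [s] and [t] determine the added edge, so the sum defining the coefficient has a
    single term. *)
Lemma adds_coef s e t : adds s e t ->
  coef (@nbc_diff V E le) s t = edge_sign le (ed s) e.
Proof.
move=> a; rewrite coef_nbc_diff ffunE (big_pred1 e) // => f; rewrite in_setD.
apply/idP/eqP => [/andP[/andP[fF fE] sf] | ->]; last first.
  by case/and3P: a => -> -> ->.
have af : adds s f t by rewrite /adds fE fF.
have : f \in e |: ed s by rewrite -(adds_ed a) (adds_ed af) setU11.
by rewrite in_setU1 => /orP[/eqP // | fF']; rewrite /ed fF' in fF.
Qed.

Lemma adds_unit s e t : adds s e t ->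
  coef (@nbc_diff V E le) s t \is a GRing.unit.
Proof. by move/adds_coef->; rewrite /edge_sign GRing.unitrX // GRing.unitrN1. Qed.

Lemma adds_hasse s e t : adds s e t -> hasse (@nbc_diff V E le) s t.
Proof.
move/adds_unit => H; apply: contraTneq H => ->; by rewrite GRing.unitr0.
Qed.

(* Adding e to s, or removing it, merges or splits off a component labelled 1
   at the far end of e. *)
Definition toggles s e : bool :=
  (e \in bridges (ed s)) &&
  ((e \in ed s) || [forall v, far (ed s) e v ==> (v \notin xs s)]).

(** * Pivots, and their stability under adding and removing them *)

Definition pivot s e : bool :=
  toggles s e && [forall f, toggles s f ==> le f e].

Lemma toggles_E s e : toggles s e -> e \in E.
Proof. by case/andP=> /(subsetP (bridges_sub _)). Qed.

Lemma pivot_toggles s e : pivot s e -> toggles s e.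
Proof. by case/andP. Qed.

Lemma pivot_max s e f : pivot s e -> toggles s f -> le f e.
Proof. by case/andP=> _ /forallP/(_ f)/implyP. Qed.

Lemma pivot_unique s e f : pivot s e -> pivot s f -> e = f.
Proof.
move=> pe pf; apply: le_antisym_in (toggles_E (pivot_toggles pe)) _ _ _.
- exact: toggles_E (pivot_toggles pf).
- exact: pivot_max (pivot_toggles pe).
- exact: pivot_max (pivot_toggles pf).
Qed.

Lemma pivot_exists s e : toggles s e -> exists f, pivot s f.
Proof.
move=> te; pose A := [set f | toggles s f].
have sAE : A \subset E by apply/subsetP=> f; rewrite inE => /toggles_E.
have An0 : A != set0 by apply/set0Pn; exists e; rewrite inE.
have [f fA fmax] := exists_maximum le_total le_trans sAE An0.
exists f; rewrite inE in fA; rewrite /pivot fA; apply/forallP=> g.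
by apply/implyP=> gA; apply: fmax; rewrite inE.
Qed.

Definition far_unlabelled s e : Prop :=
  forall v, far (ed s) e v -> v \notin xs s.

Lemma toggles_far s e : toggles s e -> e \notin ed s -> far_unlabelled s e.
Proof.
by case/andP=> _ /orP[-> // | /forallP H] _ v fv; apply: (implyP (H v)).
Qed.

(** Above [e] nothing changes but the labels, and the vertices labelled x only increase, so no edge
    above [e] starts to toggle. *)
Lemma pivot_adds s e t : adds s e t -> pivot s e -> pivot t e.
Proof.
move=> a pe; have te := pivot_toggles pe; have eE := toggles_E te.
have agr := adds_agree a.
apply/andP; split.
  case/andP: te => eB _; rewrite /toggles (adds_ed a) setU11 andbT.
  by rewrite -(adds_ed a) -(bridges_agree eE eE _ agr) // le_refl_in.
apply/forallP=> f; apply/implyP=> tf; have fE := toggles_E tf.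
have [-> | fe] := eqVneq f e; first exact: le_refl_in.
have /orP[ef | //] := le_total eE fE.
apply: (pivot_max pe); case/andP: tf => fB H.
rewrite /toggles (bridges_agree eE fE ef agr) fB /= (agr f) //.
case/orP: H => [-> // | /forallP H]; apply/orP; right; apply/forallP=> v.
apply/implyP=> fv; rewrite (far_agree _ eE fE ef agr) in fv.
apply: contra (implyP (H v) fv); exact: (subsetP (adds_xs_sub a)).
Qed.

(** The danger is an edge [f] above [e] whose far component is labelled 1 in [s] and x in [t]. The
    label would have come across [e]: from the far side of [e], which is labelled 1, or into it,
    where [far_not_connected] forbids the far end of [f]. *)
Lemma pivot_removes s e t :
  adds s e t -> far_unlabelled s e -> pivot t e -> pivot s e.
Proof.
move=> a fs pe; have te := pivot_toggles pe; have eE := toggles_E te.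
have agr := adds_agree a.
have eBs : e \in bridges (ed s).
  by rewrite (bridges_agree eE eE _ agr) ?le_refl_in //; case/andP: te.
have eF : e \notin ed s by case/and3P: a.
apply/andP; split.
  rewrite /toggles eBs; apply/orP; right; apply/forallP=> v.
  by apply/implyP; exact: fs.
apply/forallP=> f; apply/implyP=> tf; have fE := toggles_E tf.
have [-> | fe] := eqVneq f e; first exact: le_refl_in.
have /orP[ef | //] := le_total eE fE.
apply: (pivot_max pe); case/andP: tf => fB H.
rewrite /toggles -(bridges_agree eE fE ef agr) fB /= -(agr f) //.
case/orP: H => [-> // | /forallP H]; apply: contraT; rewrite negb_or.
case/andP=> fF /forallPn[v]; rewrite negb_imply negbK => /andP[fv vX].
rewrite -(far_agree _ eE fE ef agr) in fv; have vXs := implyP (H v) fv.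
move: vX; rewrite (adds_xs _ a) => /exists_inP[y yX]; rewrite (adds_ed a).
have [c [z [ee fz _ _]]] := far_near (ed_sub s) eBs.
rewrite ee => /connect_add_edge[vy | [vc zy] | [vz cy]].
- by rewrite (xs_connect vy) yX in vXs.
- by have := fs z fz; rewrite (xs_connect zy) yX.
rewrite adj_connect_sym in vz.
by have := far_not_connected (ed_sub s) eBs fB eF fF ef _ fz fv;
  rewrite eq_sym fe vz => /(_ isT).
Qed.

(** The far component is labelled 1, so the product of labels is not zero; and adding a bridge
    preserves NBC. *)
Lemma pivot_up s e : pivot s e -> e \notin ed s -> exists t, adds s e t.
Proof.
move=> pe eF; have te := pivot_toggles pe; have eE := toggles_E te.
have eB : e \in bridges (ed s) by case/andP: te.
have [y [z [ee fz _ _]]] := far_near (ed_sub s) eB; have zX := toggles_far te eF fz.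
have nF := completion_add_nbc (ed_nbc s) eB.
rewrite ee in eE eF nF *; apply: adds_defined => // _ zX'.
by rewrite zX' in zX.
Qed.

(** Since the far part is labelled 1, the near part must carry the label of the merged component, so
    [t] determines the labels before the merge. *)
Lemma removes_unique s s' e t : adds s e t -> adds s' e t ->
    e \in bridges (ed s) -> far_unlabelled s e -> far_unlabelled s' e -> s = s'.
Proof.
move=> a a' eB fs fs'; have eF : e \notin ed s by case/and3P: a.
have eF' : e \notin ed s' by case/and3P: a'.
have eqF : ed s = ed s'.
  by rewrite -(setU1K eF) -(setU1K eF') -(adds_ed a) -(adds_ed a').
apply: nbc_state_ext => //.
wlog suff sub : s s' a a' eB fs fs' eF eF' eqF / xs s \subset xs s'.
  by apply/eqP; rewrite eqEsubset (sub s s') // (sub s' s) // -eqF.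
apply/subsetP=> w wX; have := subsetP (adds_xs_sub a) w wX.
rewrite (adds_xs _ a') => /exists_inP[y yX]; rewrite (adds_ed a').
have [c [z [ee fz _ _]]] := far_near (ed_sub s) eB; rewrite {1}ee.
case/connect_add_edge => [wy | [_ zy] | [wz _]].
- by rewrite (xs_connect wy).
- by have := fs' z; rewrite -eqF fz (xs_connect zy) yX => /(_ isT).
- by rewrite -eqF in wz; have := fs z fz; rewrite -(xs_connect wz) wX.
Qed.

Lemma pivot_down t e : pivot t e -> e \in ed t ->
  exists s, adds s e t /\ far_unlabelled s e.
Proof.
move=> pe eT; have te := pivot_toggles pe; have eE := toggles_E te.
have eB : e \in bridges (ed t) by case/andP: te.
have [y [z [ee fz _ nyz]]] := far_near (ed_sub t) eB.
pose F := ed t :\ e; have eF : e \notin F by rewrite setD11.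
have defF : e |: F = ed t by rewrite setD1K.
have agr : agree_above e F (ed t) by move=> f fE fe _; rewrite in_setD1 fe.
have sFt : F \subset ed t := subsetDl _ _.
have nyzF : ~~ connect (adj F) y z.
  apply: contra nyz; apply: connect_subset.
  rewrite -(rest_agree eE (completion_agree eE agr)).
  apply: subset_trans (rest_mono _ (subsetUl _ _)).
  exact: sub_rest (subset_trans sFt (ed_sub t)) eF.
(* The far part receives the label 1; every other vertex keeps its label. *)
have [|||s [es xss]] := @nbc_state_build F (xs t :\: component F z).
- exact: subset_trans sFt (ed_sub t).
- exact: nbc_subset sFt (ed_nbc t).
- move=> u v uv /setDP[uX nzu]; apply/setDP; split.
    by rewrite -(xs_connect (connect_subset sFt uv)).
  apply: contra nzu; rewrite !inE => zv; rewrite adj_connect_sym in uv.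
  exact: connect_trans zv uv.
have zs : z \notin xs s by rewrite xss in_setD inE connect0.
have fs : far_unlabelled s e.
  move=> v; rewrite es (far_agree _ eE eE _ agr) ?le_refl_in // => fv.
  by rewrite (far_unique (ed_sub t) eB fv fz).
exists s; split => //.
have [||||t' a] := @adds_defined s y z; rewrite -?ee ?es ?defF //.
- by move=> _ zX; rewrite zX in zs.
- exact: ed_nbc.
suff <- : t' = t by rewrite ee.
rewrite -ee in a; have et' : ed t' = ed t by rewrite (adds_ed a) es.
apply: nbc_state_ext => //; apply/setP=> w; rewrite (adds_xs _ a) et' xss.
apply/exists_inP/idP => [[v /setDP[vX _] wv] | wX].
  by rewrite (xs_connect wv).
have [zw | nzw] := boolP (connect (adj F) z w); last first.
  by exists w; rewrite ?connect0 // in_setD wX inE nzw.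
have wy : connect (adj (ed t)) w y.
  rewrite adj_connect_sym; apply: connect_trans (connect_subset sFt zw).
  by apply: connect_edge; rewrite -ee.
(* The near end [y] has kept the label x of the component that was split. *)
exists y => //; rewrite in_setD -(xs_connect wy) wX andbT inE.
by rewrite adj_connect_sym.
Qed.

(** * The matching along pivots *)

Definition pivot_matching : {set nbc_state E le * nbc_state E le} :=
  [set p | [exists e, adds p.1 e p.2 && pivot p.1 e]].

Lemma pivot_matchingP s t :
  reflect (exists e, adds s e t /\ pivot s e) ((s, t) \in pivot_matching).
Proof.
rewrite inE; apply: (iffP existsP) => -[e]; first by case/andP; exists e.
by case=> a pe; exists e; rewrite a.
Qed.

Lemma pivot_matching_pivots s t : (s, t) \in pivot_matching ->
  exists e, [/\ adds s e t, pivot s e, pivot t e & far_unlabelled s e].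
Proof.
case/pivot_matchingP=> e [a pe]; exists e; split=> //.
  exact: pivot_adds pe.
by apply: toggles_far (pivot_toggles pe) _; case/and3P: a.
Qed.

(** The added edge is the pivot of both members of a pair, so pairs sharing a state add the same
    edge. That edge tells lower from upper members, and each of the two determines the other. *)
Lemma pivot_matching_is_matching :
  matching (@nbc_diff V E le) pivot_matching.
Proof.
split=> [[s t] /pivot_matchingP[e [a _]] | ]; first exact: adds_hasse a.
case=> s t [s' t'] /pivot_matching_pivots[e [a ps pt fs]].
case/pivot_matching_pivots=> e' [a' ps' pt' fs'] /= neq.
have [et es] := (adds_in a, adds_notin a).
have [et' es'] := (adds_in a', adds_notin a').
have eqs : s = s' -> False.
  move=> ss'; rewrite -{}ss' in a' ps' es' fs' neq.
  have ee := pivot_unique ps ps'; rewrite -ee in a'; case/negP: neq.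
  apply/eqP; congr pair; do 2!apply: val_inj.
  case/and3P: a => _ _ /eqP; case/and3P: a' => _ _ /eqP-> .
  by case.
have eqt : t = t' -> False.
  move=> tt'; rewrite -{}tt' in a' pt' et' neq.
  have ee := pivot_unique pt pt'; rewrite -ee in a' fs'; apply: eqs.
  by apply: removes_unique a a' _ fs fs'; case/andP: (pivot_toggles ps).
have st' : s = t' -> False.
  by move=> E'; rewrite -E' in pt' et'; rewrite -(pivot_unique ps pt') (negPf es) in et'.
have ts' : t = s' -> False.
  by move=> E'; rewrite -E' in ps' es'; rewrite -(pivot_unique pt ps') et in es'.
rewrite -setI_eq0; apply/eqP/setP=> c; rewrite !inE.
by apply/negP=> /andP[/orP[]/eqP-> /orP[]/eqP].
Qed.

(** * Critical states and signed NBC trees *)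

Lemma critical_toggles s :
  critical pivot_matching s = ~~ [exists e, toggles s e].
Proof.
apply/idP/existsPn => [/forall_inP cr e | nt].
  apply/negP=> /pivot_exists[f pf].
  have [fs | fs] := boolP (f \in ed s).
    have [r [a fr]] := pivot_down pf fs.
    have /cr : (r, s) \in pivot_matching.
      by apply/pivot_matchingP; exists f; split=> //; exact: pivot_removes a fr pf.
    by rewrite eqxx andbF.
  have [t a] := pivot_up pf fs.
  have /cr : (s, t) \in pivot_matching by apply/pivot_matchingP; exists f.
  by rewrite eqxx.
apply/forall_inP=> -[r t] /pivot_matching_pivots[e [_ pr pt _]] /=.
apply/andP; split; apply/eqP=> E'.
  by case/negP: (nt e); rewrite E' pivot_toggles.
by case/negP: (nt e); rewrite E' pivot_toggles.
Qed.

Lemma critical_passive s : critical pivot_matching s -> passive (ed s).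
Proof.
rewrite critical_toggles => /existsPn nt; apply/pred0P=> e /=.
by apply/negP=> /andP[eF eB]; case/negP: (nt e); rewrite /toggles eB eF.
Qed.

Lemma critical_far s e v : critical pivot_matching s ->
  e \in bridges (ed s) -> far (ed s) e v -> v \in xs s.
Proof.
rewrite critical_toggles => /existsPn nt eB fv.
have := nt e; rewrite /toggles eB /= negb_or => /andP[_ /forallPn[z]].
rewrite negb_imply negbK => /andP[fz zX].
by rewrite (far_unique (ed_sub s) eB fv fz).
Qed.

(** Every component other than that of the root contains the far end of a bridge, and criticality
    labels it x. *)
Lemma critical_root s w : critical pivot_matching s ->
  w \in xs s = (connect (adj (ed s)) vd w ==> (vd \in xs s)).
Proof.
move=> cs; have [vdw | nvdw] /= := boolP (connect _ vd w).
  by rewrite (xs_connect vdw).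
have [e [v [eB fv vw]]] := passive_far (ed_sub s) (critical_passive cs) nvdw.
by rewrite -(xs_connect vw) (critical_far cs eB fv).
Qed.

Lemma passive_completion F : passive F -> completion F :\: bridges F = F.
Proof.
move=> pF; apply/setP=> e; rewrite in_setD in_setU.
case: (e \in bridges F) (e \in F) (@disjointFr _ _ _ e pF).
  by case=> // /(_ isT).
by move=> b _; rewrite orbF.
Qed.

(** The edge set is its completion minus the bridges of that completion, and [critical_root]
    recovers all labels from the one at the root. *)
Lemma critical_inj s t :
    critical pivot_matching s -> critical pivot_matching t ->
    completion (ed s) = completion (ed t) -> (vd \in xs s) = (vd \in xs t) ->
  s = t.
Proof.
move=> cs ct eT eV; have eF : ed s = ed t.
  rewrite -(passive_completion (critical_passive cs)) eT -bridges_of_completion.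
  by rewrite eT bridges_of_completion passive_completion // critical_passive.
apply: nbc_state_ext => //; apply/setP=> w.
by rewrite (critical_root _ cs) (critical_root _ ct) eF eV.
Qed.

Lemma critical_surj T (b : bool) : nbc_tree E le T ->
  exists s, [/\ critical pivot_matching s, completion (ed s) = T
              & (vd \in xs s) = b].
Proof.
case/andP=> tT nT; pose F := T :\: bridges T.
have defT : completion F = T by exact: completion_tree_passive.
have eB : bridges F = bridges T by rewrite -defT bridges_of_completion.
have sTE : T \subset E by case/and3P: tT.
have sFE : F \subset E := subset_trans (subsetDl _ _) sTE.
have nF : nbc E le F := nbc_subset (subsetDl _ _) nT.
(* The label is x outside the root component, and is prescribed by [b] on it. *)
have [|s [es xss]] :=
    @nbc_state_build F [set w | connect (adj F) vd w ==> b] sFE nF.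
  move=> u v uv; rewrite !inE; congr (_ ==> _); rewrite adj_connect_sym in uv.
  by rewrite ![connect _ vd _]adj_connect_sym (same_connect (adj_connect_sym F) uv).
exists s; split; last by rewrite xss inE connect0.
  rewrite critical_toggles; apply/existsPn=> e; apply/negP=> /andP[eBs].
  have [_ [v [_ fv _ _]]] := far_near (ed_sub s) eBs.
  rewrite es in eBs fv *; have eF : e \notin F by rewrite in_setD -eB eBs.
  rewrite (negPf eF) /= => /forallP/(_ v)/implyP/(_ fv)/negP; case.
  (* A far end in the root component would be joined to the root by [F], which survives in the graph
     defining [far]. *)
  rewrite xss inE; apply/implyP=> vdv; case/andP: fv => _ /negP; case.
  apply: connect_subset vdv; apply: subset_trans (sub_rest sFE eF) _.
  exact: rest_mono (subsetUl _ _).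
by rewrite es.
Qed.

(** The boolean is the sign: [true] when the root component is labelled x. *)
Definition critical_tree (c : {c : nbc_state E le | critical pivot_matching c}) :
    {T : {set {set V}} | nbc_tree E le T} * bool :=
  (Sub (completion (ed (val c))) (completion_nbc_tree (ed_sub _) (ed_nbc _)),
   vd \in xs (val c)).

Lemma critical_tree_bij : bijective critical_tree.
Proof.
have inj : injective critical_tree.
  move=> c c' ecc'; apply: val_inj; apply: critical_inj (valP c) (valP c') _ _.
    by have := congr1 (fun p => val p.1) ecc'.
  by have := congr1 snd ecc'.
have surj p : exists c, critical_tree c == p.
  case: p => -[T nT] b; have [s [cs eT eb]] := critical_surj b nT.
  exists (Sub s cs); apply/eqP; congr pair; last exact: eb.
  exact: val_inj.
exists (fun p => xchoose (surj p)) => [c | p]; last exact/eqP/(xchooseP (surj p)).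
exact/inj/eqP/(xchooseP (surj _)).
Qed.

(** * Monotone counts and acyclicity *)

Lemma leq_card_rel (K : finType) (A B : {set K}) (R : rel K) :
    (forall a, a \in A -> exists2 b, b \in B & R a b) ->
    (forall a a' b, a \in A -> a' \in A -> R a b -> R a' b -> a = a') ->
  #|A| <= #|B|.
Proof.
move=> tot inj; pose f a := odflt a [pick b in B | R a b].
have fP a : a \in A -> (f a \in B) && R a (f a).
  move=> aA; rewrite /f; case: pickP => [b // | no] /=.
  by have [b bB ab] := tot a aA; have := no b; rewrite /= bB ab.
rewrite -(@card_in_imset _ _ f A); last first.
  move=> a a' aA a'A faa'; have /andP[_ ra] := fP a aA.
  by have /andP[_] := fP a' a'A; rewrite -faa'; exact: inj.
by apply/subset_leq_card/subsetP=> _ /imsetP[a aA ->]; have /andP[] := fP a aA.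
Qed.

(* With B the far side of the largest edge varying along a cycle, the number of
   these components never increases along it. *)
Definition xcomps (B : {set V}) s : {set {set V}} :=
  [set C in comps (ed s) | (C \subset B) && (C \subset xs s)].

Lemma xcompsP (B C : {set V}) s : reflect
  (exists w, [/\ C = component (ed s) w, component (ed s) w \subset B
               & w \in xs s]) (C \in xcomps B s).
Proof.
rewrite inE; apply: (iffP andP) => [[/compsP[w eC] /andP[sB sX]] | [w [-> sB wX]]].
  exists w; split; rewrite ?/component -?eC //.
  by apply: (subsetP sX); rewrite eC inE connect0.
split; first exact: component_comps.
rewrite sB; apply/subsetP=> v; rewrite inE => wv; by rewrite -(xs_connect wv).
Qed.

(** Each x-component of [t] inside [B] contains an x-component of [s], and distinct ones contain
    distinct ones. Counting only those so contained prepares the strict inequality. *)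
Lemma xcomps_adds (B : {set V}) s e t : adds s e t ->
  #|xcomps B t| <= #|[set C in xcomps B s | [exists D in xcomps B t, C \subset D]]|.
Proof.
move=> a; apply: (@leq_card_rel _ _ _ (fun D C : {set V} => (C != set0) && (C \subset D))).
  move=> D DB; have /xcompsP[w [eD sDB wX]] := DB.
  move: wX; rewrite (adds_xs _ a) => /exists_inP[y yX wy].
  have sCD : component (ed s) y \subset D.
    rewrite eD; apply/subsetP=> v; rewrite !inE => yv; apply: connect_trans wy _.
    by apply: connect_subset yv; rewrite (adds_ed a) subsetUr.
  exists (component (ed s) y).
    apply/setIdP; split; last by apply/exists_inP; exists D.
    by apply/xcompsP; exists y; split=> //; rewrite (subset_trans sCD) // eD.
  by rewrite sCD andbT; apply/set0Pn; exists y; rewrite inE connect0.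
move=> D D' C /xcompsP[w [-> _ _]] /xcompsP[w' [-> _ _]].
case/andP=> /set0Pn[v vC] sC /andP[_ sC'].
have := subsetP sC v vC; have := subsetP sC' v vC; rewrite !inE => w'v wv.
by rewrite (eq_component wv) (eq_component w'v).
Qed.

Lemma leq_xcomps_adds (B : {set V}) s e t : adds s e t -> #|xcomps B t| <= #|xcomps B s|.
Proof.
move=> a; apply: leq_trans (xcomps_adds B a) (subset_leq_card _).
by apply/subsetP=> C; rewrite inE => /andP[].
Qed.

(** The component of [z] is merged with [y], outside [B], so it lies in no component of [t] inside
    [B]. *)
Lemma ltn_xcomps_adds (B : {set V}) s e t y z : adds s e t -> e = [set y; z] ->
    z \in xs s -> component (ed s) z \subset B -> y \notin B ->
  #|xcomps B t| < #|xcomps B s|.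
Proof.
move=> a ee zX sB yB; apply: leq_ltn_trans (xcomps_adds B a) (proper_card _).
rewrite properE; apply/andP; split.
  by apply/subsetP=> C; rewrite inE => /andP[].
apply/subsetPn; exists (component (ed s) z).
  by apply/xcompsP; exists z.
rewrite inE negb_and; apply/orP; right; apply/exists_inP=> -[D].
case/xcompsP=> w [-> sDB _] szD; case/negP: yB; apply: (subsetP sDB).
have : z \in component (ed t) w by apply: (subsetP szD); rewrite inE connect0.
rewrite !inE => wz; apply: connect_trans wz (connect_edge _).
by rewrite setUC -ee (adds_in a).
Qed.

(** Sending a component of [s] to the one of [t] containing it is injective on x-components, since
    these never merge. *)
Lemma leq_xcomps_removes (B : {set V}) s e t : adds s e t ->
    (forall w, w \in xs s -> component (ed s) w \subset B ->
       component (ed t) w \subset B) ->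
  #|xcomps B s| <= #|xcomps B t|.
Proof.
move=> a H; apply: (@leq_card_rel _ _ _ (fun C D : {set V} =>
  [exists w in xs s, (C == component (ed s) w) && (D == component (ed t) w)])).
  move=> C /xcompsP[w [-> sB wX]]; exists (component (ed t) w).
    apply/xcompsP; exists w; split; rewrite ?H //.
    exact: (subsetP (adds_xs_sub a)).
  by apply/exists_inP; exists w; rewrite ?eqxx.
move=> C C' D _ _ /exists_inP[w wX /andP[/eqP-> /eqP->]].
case/exists_inP=> w' wX' /andP[/eqP-> /eqP/component_eq ww'].
exact/eq_component/(adds_connect a).
Qed.

(** Going round the cycle makes a quantity that is monotone along its steps constant. *)
Lemma cycle_rel (K : eqType) (r R : rel K) (c : seq K) : transitive R ->
    cycle r c -> (forall a b, a \in c -> b \in c -> r a b -> R a b) ->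
  forall a b, a \in c -> b \in c -> R a b.
Proof.
move=> trR cr H; have : cycle R c.
  apply: (@sub_in_cycle _ (mem c) r) cr; last exact/allP.
  by move=> a b ac bc; exact: H.
by rewrite cycle_all2rel // => /allrelP.
Qed.

Lemma reversed_step s t : reversed (@nbc_diff V E le) pivot_matching s t ->
  (exists2 g, adds s g t & (s, t) \notin pivot_matching) \/
  (t, s) \in pivot_matching.
Proof.
case/orP=> [/andP[/hasse_adds[g a] nM] | ]; last by right.
by left; exists g.
Qed.

Lemma pivot_matching_acyclic (c : seq (nbc_state E le)) :
  cycle (reversed (@nbc_diff V E le) pivot_matching) c -> c = [::].
Proof.
case: c => // c0 c1; move: (c0 :: c1) (mem_head c0 c1) => c c0c cyc.
exfalso; set r := reversed _ _ in cyc.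
have nextP s : s \in c -> next c s \in c /\ r s (next c s).
  by move=> sc; rewrite mem_next sc; split=> //; exact: next_cycle.
pose W := [set g in E | has (fun s => g \in ed s) c && has (fun s => g \notin ed s) c].
have WP s t g : s \in c -> t \in c -> adds s g t -> g \in W.
  move=> sc tc a; rewrite inE; case/and3P: (a) => -> gs _ /=.
  by apply/andP; split; apply/hasP; [exists t; rewrite ?(adds_in a) | exists s].
have Wn0 : W != set0.
  have [nc /reversed_step[[g a _] | /pivot_matchingP[g [a _]]]] := nextP c0 c0c;
    by apply/set0Pn; exists g; apply: WP a.
have sWE : W \subset E by apply/subsetP=> g /setIdP[].
have [e eW emax] := exists_maximum le_total le_trans sWE Wn0.
have eE := subsetP sWE e eW.
(* No edge above [e] varies, so the bridges from [e] upwards and their far ends are the same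
   throughout the cycle. *)
have agr s t : s \in c -> t \in c -> agree_above e (ed s) (ed t).
  have half s' t' f : s' \in c -> t' \in c -> f \in E -> f != e -> le e f ->
      f \in ed s' -> f \in ed t'.
    move=> sc tc fE fe ef fs; apply: contraNT fe => ft.
    apply/eqP/le_antisym_in => //; apply: emax; apply/setIdP; split=> //.
    by apply/andP; split; apply/hasP; [exists s' | exists t'].
  by move=> sc tc f fE fe ef; apply/idP/idP; apply: half.
have [/hasP[s1 s1c es1] /hasP[s2 s2c es2]] : has (fun s => e \in ed s) c /\
    has (fun s => e \notin ed s) c by apply/andP; case/setIdP: eW.
have addP a b : a \in c -> b \in c -> r a b -> e \notin ed a -> e \in ed b ->
    adds a e b /\ (a, b) \notin pivot_matching.
  move=> _ _ /reversed_step[[g ag nM] ea | /pivot_matchingP[m [am _]] ea].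
    by rewrite (adds_ed ag) in_setU1 (negPf ea) orbF => /eqP ->.
  by move=> eb; rewrite (adds_ed am) in_setU1 eb orbT in ea.
have remP a b : a \in c -> b \in c -> r a b -> e \in ed a -> e \notin ed b ->
    pivot b e.
  move=> _ _ /reversed_step[[g ag _] ea | /pivot_matchingP[m [am pm]] ea eb].
    by rewrite (adds_ed ag) in_setU1 ea orbT.
  by move: ea; rewrite (adds_ed am) in_setU1 (negPf eb) orbF => /eqP ->.
(* Since [e] varies, it is removed at some step, and there it is a pivot, hence a bridge. *)
have eBr s : s \in c -> e \in bridges (ed s).
  move=> sc.
  have [/hasP[b bc pb] | /hasPn nop] := boolP (has (fun b => pivot b e) c).
    rewrite (bridges_agree eE eE (le_refl_in eE) (agr s b sc bc)).
    by case/andP: (pivot_toggles pb).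
  pose R s t := (e \in ed s) ==> (e \in ed t).
  have trR : transitive R by rewrite /R => b a d; case: (e \in ed a) => //= ->.
  suff : R s1 s2 by rewrite /R es1 (negPf es2).
  apply: (cycle_rel trR cyc _ s1c s2c) => a b ac bc rab.
  apply/implyP=> ea; apply: contraT => eb.
  by case/negP: (nop b bc); exact: remP rab ea eb.
have [a [b [ac bc ab eab nM]]] : exists a b, [/\ a \in c, b \in c, r a b,
    adds a e b & (a, b) \notin pivot_matching].
  have [/hasP[a ac /hasP[b bc /and3P[rab ea eb]]] | no] := boolP (has (fun a =>
      has (fun b => [&& r a b, e \notin ed a & e \in ed b]) c) c).
    by exists a, b; have [] := addP a b ac bc rab ea eb.
  pose R s t := (e \in ed t) ==> (e \in ed s).
  have trR : transitive R.
    by rewrite /R => n m p;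
       case: (e \in ed m); case: (e \in ed n); case: (e \in ed p).
  suff : R s2 s1 by rewrite /R es1 (negPf es2).
  apply: (cycle_rel trR cyc _ s2c s1c) => a b ac bc rab.
  apply/implyP=> eb; apply: contraR no => ea.
  by apply/hasP; exists a => //; apply/hasP; exists b => //; rewrite rab ea.
(* psi is constant on the cycle, so steps up and steps down alternate. *)
pose upper t := [exists s, (s, t) \in pivot_matching].
pose psi s := #|ed s| + ~~ upper s.
have psiP s t : s \in c -> t \in c -> psi s = psi t.
  have psi_le s' t' : s' \in c -> t' \in c -> psi s' <= psi t'.
    have trR : transitive (fun s t => psi s <= psi t).
      by move=> n m p; exact: leq_trans.
    move: s' t'; apply: (cycle_rel trR cyc) => x y _ _ /reversed_step[[g ag _]|xM].
      rewrite /psi (adds_ed ag) cardsU1 (adds_notin ag).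
      by rewrite -addnA addnCA leq_add2l (leq_trans (leq_b1 _)) ?leq_addr.
    have ux : upper x by apply/existsP; exists y.
    have [m [am pm _ _]] := pivot_matching_pivots xM.
    have uy : ~~ upper y.
      apply/existsPn=> z; apply/negP=> /pivot_matching_pivots[m2 [a2 _ q2 _]].
      by have := adds_notin am; rewrite (pivot_unique pm q2) (adds_in a2).
    by rewrite /psi ux uy (adds_ed am) cardsU1 (adds_notin am) addn0 addnC.
  by move=> sc tc; apply/eqP; rewrite eqn_leq !psi_le.
(* The size grows by one from [a] to [b], so constancy of [psi] makes [b] the upper member of a
   pair; it then forbids a further step up. *)
have ub : upper b.
  have := psiP a b ac bc; rewrite /psi (adds_ed eab) cardsU1 (adds_notin eab).
  case: (upper b) => //; case: (upper a); rewrite /= ?addn0 ?addn1 ?add1n.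
    by move/eqP; rewrite -[X in X == _]addn0 -addn2 eqn_add2l.
  by move/eqP; rewrite eqn_leq ltnn andbF.
have [nc rn] := nextP b bc; set n := next c b in nc rn.
case/reversed_step: rn => [[g ag _] | nbM].
  have := psiP b n bc nc; rewrite /psi ub (adds_ed ag) cardsU1 (adds_notin ag).
  by move/eqP; rewrite eqn_leq addn0 andbC add1n ltnNge leq_addr.
have [m [am pn pb fn]] := pivot_matching_pivots nbM.
(* The removed edge varies, so it is at most [e]; it is the pivot of [b], where [e] toggles, so it
   is at least [e]. *)
have me : m = e.
  apply: le_antisym_in (toggles_E (pivot_toggles pn)) eE _ _.
    exact/emax/(WP n b).
  by apply: (pivot_max pb); rewrite /toggles eBr // (adds_in eab).
rewrite {}me in am fn pn pb.
(* Then [a] and [n] coincide, although [(a, b)] is unmatched and [(n, b)] is matched. *)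
suff fa : far_unlabelled a e.
  have an : a = n := removes_unique eab am (eBr a ac) fa fn.
  by rewrite an nbM in nM.
have [y [z [ee fz _ nyz]]] := far_near (ed_sub a) (eBr a ac).
move=> v fv; rewrite (far_unique (ed_sub a) (eBr a ac) fv fz) {v fv}.
(* By [agr], this graph and the far side [B] of [e] in it are common to all states of the cycle. *)
set G := rest _ e in nyz; pose B := component G z.
have yB : y \notin B by rewrite inE adj_connect_sym.
have sG s : s \in c -> e \notin ed s -> ed s \subset G.
  move=> sc es; rewrite /G (rest_agree eE (completion_agree eE (agr a s ac sc))).
  exact: subset_trans (sub_rest (ed_sub s) es) (rest_mono _ (subsetUl _ _)).
have stepB s t : s \in c -> t \in c -> #|xcomps B s| <= #|xcomps B t|.
  have trR : transitive (fun s t => #|xcomps B t| <= #|xcomps B s|).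
    by move=> x1 x2 x3 x21 x13; exact: leq_trans x13 x21.
  move=> sc tc; apply: (cycle_rel trR cyc _ tc sc) => {sc tc s t} s t sc tc.
  case/reversed_step=> [[g ag _] | tsM]; first exact: leq_xcomps_adds ag.
  have [m' [am' pt ps ft]] := pivot_matching_pivots tsM.
  apply: (leq_xcomps_removes am') => w wX swB.
  (* If another edge is removed, [e] is absent before the step, so components stay on one side of
     [e]. If [e] is removed, its far component is labelled 1 after the step, so no x-component
     inside [B] touched [e]. *)
  have [me | nme] := eqVneq m' e; last first.
    have es : e \notin ed s.
      apply: contraNN nme => es; apply/eqP/le_antisym_in => //.
      - exact: toggles_E (pivot_toggles pt).
      - exact/emax/(WP t s).
      - by apply: (pivot_max ps); rewrite /toggles eBr ?es.
    have : w \in B by apply: (subsetP swB); rewrite inE connect0.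
    rewrite inE => zw; apply/subsetP=> v; rewrite !inE => wv.
    by apply: connect_trans zw (connect_subset _ wv); exact: sG.
  rewrite {}me in am' ft.
  have zX : z \notin xs t.
    by apply: ft; rewrite -(far_agree _ eE eE (le_refl_in eE) (agr a t ac tc)).
  apply/subsetP=> v; rewrite inE (adds_ed am') ee.
  case/connect_add_edge => [wv | [wy _] | [wz _]].
  - by apply: (subsetP swB); rewrite inE.
  - by case/negP: yB; apply: (subsetP swB); rewrite inE.
  - by rewrite -(xs_connect wz) wX in zX.
(* Were the far component of [a] labelled x, adding [e] would take it out of [B] and lower a
   constant count. *)
apply/negP=> zX.
have := ltn_xcomps_adds eab ee zX _ yB; rewrite ltnNge stepB // => /(_ _)/negP.
case=> //; apply/subsetP=> v; rewrite !inE => zv; apply: connect_subset zv.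
exact: sG (adds_notin eab).
Qed.

End Bridges.

Theorem theorem3p6 (V : finType) (E : {set {set V}}) (le : rel {set V}) (vd : V)
    (simpleE : forall e : {set V}, e \in E -> #|e| = 2)
    (connE : connected_graph E)
    (le_total : {in E &, total le})
    (le_anti : {in E &, antisymmetric le})
    (le_trans : {in E & &, transitive le}) :
  exists M : {set nbc_state E le * nbc_state E le},
    acyclic_matching (@nbc_diff V E le) M /\
    exists f : {c : nbc_state E le | critical M c} ->
               {T : {set {set V}} | nbc_tree E le T} * bool,
      bijective f.
Proof.
exists (pivot_matching E le vd); split.
  split; first exact: pivot_matching_is_matching.
    by move=> [s t] /pivot_matchingP[e [a _]]; exact: adds_unit a.
  exact: pivot_matching_acyclic.
exists (critical_tree simpleE connE le_total le_anti le_trans).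
exact: critical_tree_bij.
Qed.
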